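(* Let $\mathrm{Gr}_{\mathbf b}(k,n)$ be a divisive weighted Grassmann orbifold, with $b_i$ dividing $b_{i-1}$ for all $i=1,\dots,m$. For all $i,j,\ell\in\{0,\dots,m\}$ the equivariant structure constant ${\bf b}\widetilde{\mathscr C}_{i\,j}^{\ell}$ is given by $${\bf b}\widetilde{\mathscr C}_{i\,j}^{\ell}=\sum_{q:\ \lambda^\ell\succeq\lambda^q\succeq\lambda^i,\lambda^j}\ \sum_{R}\ \sum_{s=0}^{|R|}K(i,j,q,R)\,\mathcal L_{s,R}\,{\bf b}\widetilde{\mathscr C}_{q\,g^s}^{\ell},$$ where $\lambda^q\succeq\lambda^i,\lambda^j$ means $\lambda^q\succeq\lambda^i$ and $\lambda^q\succeq\lambda^j$, and $R$ runs over the finite multisets of elements of $\{1,\dots,n-1\}$ with $|R|=d(\lambda^i)+d(\lambda^j)-d(\lambda^q)$.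
   Context: Let $1\le k<n$ and $m+1=\binom nk$. A Schubert symbol for $k<n$ is a sequence $\lambda=(\lambda_1<\dots<\lambda_k)$ of integers in $\{1,\dots,n\}$ (identified with its underlying set). Write $\lambda\preceq\mu$ iff $\lambda_i\le\mu_i$ for all $i$, and fix a total order $\lambda^0<\lambda^1<\dots<\lambda^m$ of all Schubert symbols refining $\preceq$. With $e_1,\dots,e_n$ the standard basis of $\mathbb C^n$ and $e_\lambda=e_{\lambda_1}\wedge\dots\wedge e_{\lambda_k}$, identify $\Lambda^k(\mathbb C^n)$ with $\mathbb C^{m+1}$ by $z=\sum_i z_ie_{\lambda^i}$. Let $Pl(k,n)=\{a_1\wedge\dots\wedge a_k: a_i\in\mathbb C^n\}\setminus\{0\}$. $\mathbf b=(b_0,\dots,b_m)\in(\mathbb Z_{\ge1})^{m+1}$ is a Plücker weight vector if for all $1\le i_1<\dots<i_{k-1}\le n$ and $1\le\ell_0<\dots<\ell_k\le n$ the sum $b_{r_j}+b_{s_j}$ takes the same value for all $j\in\{0,\dots,k\}$ with $\ell_j\notin\{i_1,\dots,i_{k-1}\}$, where $\lambda^{r_j}=\{i_1,\dots,i_{k-1},\ell_j\}$ and $\lambda^{s_j}=\{\ell_0,\dots,\ell_k\}\setminus\{\ell_j\}$. For such $\mathbf b$, $\mathbb C^*$ acts on $Pl(k,n)$ by $t(z_0,\dots,z_m)=(t^{b_0}z_0,\dots,t^{b_m}z_m)$, and $\mathrm{Gr}_{\mathbf b}(k,n)$ is the orbit space with the quotient topology (a weighted Grassmann orbifold). A Plücker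 permutation is a permutation $\sigma$ of $\{0,\dots,m\}$ for which there are signs $t_i\in\{1,-1\}$ such that $(t_0z_{\sigma(0)},\dots,t_mz_{\sigma(m)})\in Pl(k,n)$ for every $z\in Pl(k,n)$; $\mathrm{Gr}_{\mathbf b}(k,n)$ is divisive if for some Plücker permutation $\sigma$, $b_{\sigma(i)}$ divides $b_{\sigma(i-1)}$ for all $i=1,\dots,m$. Up to homeomorphism one assumes (standing convention) that $b_i$ divides $b_{i-1}$ for all $i=1,\dots,m$. Put $d(\lambda)=\sum_{r=1}^k(\lambda_r-r)$. For $s\in\lambda$, $s'\notin\lambda$, $s<s'$, let $(s,s')\lambda$ be the symbol obtained by replacing $s$ by $s'$ in $\lambda$. Let $I(\lambda^i)$ be the set of all $(s,s')\lambda^i$, and $R(\lambda^i)=\{\lambda^j:\lambda^i\in I(\lambda^j)\}$. Write $\lambda^j\to\lambda^i$ if $\lambda^i\preceq\lambda^j$ and $d(\lambda^j)=d(\lambda^i)+1$. Put $Y_\lambda=\sum_{r=1}^ky_{\lambda_r}$. $T^n=(S^1)^n$ acts on $\mathrm{Gr}_{\mathbf b}(k,n)$ by $t\cdot[(z_i)]=[(t_{\lambda^i}z_i)]$, $t_\lambda=t_{\lambda_1}\cdots t_{\lambda_k}$, and $H^*_{T^n}(\mathrm{pt};\mathbb Z)=\mathbb Z[y_1,\dots,y_n]$. Restriction to the fixed points $[e_{\lambda^j}]$ (written $\alpha|_{\lambda^j}=\alpha_j$) identifies (known) $$H^*_{T^n}(\mathrm{Gr}_{\mathbf b}(k,n);\mathbb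 Z)=\Big\{\alpha\in\bigoplus_{j=0}^m\mathbb Z[y_1,\dots,y_n]:\ \big(Y_{\lambda^i}-\tfrac{b_i}{b_j}Y_{\lambda^j}\big)\text{ divides }(\alpha_j-\alpha_i)\text{ whenever }\lambda^i\in R(\lambda^j)\Big\}.$$ The equivariant Schubert class ${\bf b}\widetilde{\mathbb S}_{\lambda^i}$ is the unique element with: (1) ${\bf b}\widetilde{\mathbb S}_{\lambda^i}|_{\lambda^j}\ne0\Rightarrow\lambda^j\succeq\lambda^i$; (2) ${\bf b}\widetilde{\mathbb S}_{\lambda^i}|_{\lambda^i}=\prod_{\lambda^\ell\in R(\lambda^i)}(Y_{\lambda^\ell}-\frac{b_\ell}{b_i}Y_{\lambda^i})$; (3) each ${\bf b}\widetilde{\mathbb S}_{\lambda^i}|_{\lambda^j}$ is a homogeneous polynomial in $y_1,\dots,y_n$ of degree $d(\lambda^i)$. These classes form a $\mathbb Q[y_1,\dots,y_n]$-basis of the ring with rational coefficients, and ${\bf b}\widetilde{\mathscr C}_{i\,j}^{\ell}$ are defined by ${\bf b}\widetilde{\mathbb S}_{\lambda^i}{\bf b}\widetilde{\mathbb S}_{\lambda^j}=\sum_{\ell=0}^m{\bf b}\widetilde{\mathscr C}_{i\,j}^{\ell}\,{\bf b}\widetilde{\mathbb S}_{\lambda^\ell}$. For $\mathbf b=(1,\dots,1)$ (ordinary Grassmannian $\mathrm{Gr}(k,n)$) write $\widetilde{\mathscr C}_{i\,j}^{\ell}$ for these constants. With $u_r=y_r-y_{r+1}$ ($1\le r\le n-1$)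 and $U_R=\prod_{r\in R}u_r$ for a finite multiset $R$ in $\{1,\dots,n-1\}$, one has (Knutson–Tao) $\widetilde{\mathscr C}_{i\,j}^{\ell}=\sum_{|R|=d(\lambda^i)+d(\lambda^j)-d(\lambda^\ell)}K(i,j,\ell,R)U_R$ with $K(i,j,\ell,R)\in\mathbb Z_{\ge0}$, which defines $K(i,j,\ell,R)$. Choose $w_1,\dots,w_n\in\mathbb Z$ and $a\in\mathbb Z_{\ge 1}$ with $b_i=a+\sum_{r=1}^kw_{\lambda^i_r}$ for all $i$ (these exist, and the differences $w_r-w_{r+1}$ are determined by $\mathbf b$). Define $$\mathcal L_{s,R}=\sum_{S\subseteq R,\ |S|=s}\ \prod_{r\in S}(w_r-w_{r+1})\prod_{r\in R\setminus S}(y_r-y_{r+1}),$$ where $S$ runs over sub-collections of $R$ counted with multiplicity (i.e. $\mathcal L_{s,R}$ is the coefficient of $T^s$ in $\prod_{r\in R}((y_r-y_{r+1})+(w_r-w_{r+1})T)$). For $s\ge0$ define $${\bf b}\widetilde{\mathscr C}_{q\,g^s}^{\ell}=\sum_{\lambda^\ell=\lambda^{\ell_0}\to\lambda^{\ell_1}\to\dots\to\lambda^{\ell_r}=\lambda^q}\frac1{b_{\ell_1}b_{\ell_2}\cdots b_{\ell_r}}\sum_{J}\prod_{t=0}^r\Big(-\frac1{b_{\ell_t}}Y_{\lambda^{\ell_t}}\Big)^{j_t},$$ where $r=d(\lambda^\ell)-d(\lambda^q)$ and $J$ runs over sequences $(j_0,\dots,j_r)$ of non-negative integers with $j_0+\dots+j_r=s-r$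 (empty sums are $0$, empty products are $1$). *)

(* Defs.v *)
From HB Require Import structures.
From mathcomp Require Import all_boot all_order all_algebra all_fingroup.
From mathcomp Require Import reals.
From mathcomp Require Import complex.
From mathcomp Require Import mpoly.

Set Implicit Arguments.
Unset Strict Implicit.
Unset Printing Implicit Defensive.

Import Order.TTheory GRing.Theory Num.Theory.
Local Open Scope ring_scope.
Local Open Scope complex_scope.

(* Indices are 0-based throughout: {1, ..., n} is 'I_n, and {1, ..., n-1} is
   'I_n.-1. *)

Section Symbols.
Variables k n : nat.

Record symbol := Symbol {
  entries :> k.-tuple 'I_n;
  _ : sorted ltn (map val entries)
}.

HB.instance Definition _ := [isSub for entries].
HB.instance Definition _ := [Finite of symbol by <:].

Definition symbol_set (lam : symbol) : {set 'I_n} := [set x in entries lam].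

Definition symbol_le (lam mu : symbol) : bool :=
  [forall r : 'I_k, (tnth lam r <= tnth mu r)%N].

(* The shift to 0-based entries and positions cancels in lam_r - r, and the
   subtraction never truncates because the entries strictly increase. *)
Definition symbol_dim (lam : symbol) : nat :=
  (\sum_(r < k) (tnth lam r - r))%N.

Definition Iset (lam : symbol) : {set symbol} :=
  [set mu : symbol | [exists s : 'I_n, exists s' : 'I_n,
     [&& s \in symbol_set lam, s' \notin symbol_set lam, (s < s')%N &
         symbol_set mu == s' |: (symbol_set lam :\ s)]]].

Definition Rset (lam : symbol) : {set symbol} :=
  [set mu : symbol | lam \in Iset mu].

Definition Ysym (A : nzRingType) (lam : symbol) : {mpoly A[n]} :=
  \sum_(r < k) 'X_(tnth lam r).

End Symbols.

Section Differences.
Variable n : nat.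

Definition ord_lo (r : 'I_n.-1) : 'I_n := widen_ord (leq_pred n) r.

Lemma ord_hi_subproof (r : 'I_n.-1) : (r.+1 < n)%N.
Proof. by rewrite -ltn_predRL. Qed.

Definition ord_hi (r : 'I_n.-1) : 'I_n := Ordinal (ord_hi_subproof r).

Definition consec_diff (V : zmodType) (f : 'I_n -> V) (r : 'I_n.-1) : V :=
  f (ord_lo r) - f (ord_hi r).

Definition u_diff (r : 'I_n.-1) : {mpoly rat[n]} :=
  consec_diff (fun x => 'X_x) r.

(* A finite multiset R in {1, ..., n-1} is its multiplicity function
   R : 'X_{1..n.-1}, and |R| is mdeg R. *)
Definition U_prod (R : 'X_{1..n.-1}) : {mpoly rat[n]} :=
  \prod_r u_diff r ^+ R r.

(* {r & 'I_(R r)} lists the elements of R with multiplicity, so a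
   sub-collection S of R counted with multiplicity is a subset of it. *)
Definition L_coef (w : 'I_n -> int) (s : nat) (R : 'X_{1..n.-1}) :
    {mpoly rat[n]} :=
  \sum_(S : {set {r : 'I_n.-1 & 'I_(R r)}} | #|S| == s)
     (\prod_(x in S) (consec_diff w (tag x))%:~R) *
     \prod_(x in ~: S) u_diff (tag x).

End Differences.

Section Weighted.
Variables (k n m : nat) (lam : 'I_m.+1 -> symbol k n).

Definition refining_enumeration : Prop :=
  bijective lam /\ forall i j, symbol_le (lam i) (lam j) -> (i <= j)%N.

Definition plucker_weight_vector (b : 'I_m.+1 -> nat) : Prop :=
  (forall i, (0 < b i)%N) /\
  forall (I : symbol k.-1 n) (l : symbol k.+1 n) (j j' : 'I_k.+1)
         (r s r' s' : 'I_m.+1),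
    tnth l j \notin symbol_set I -> tnth l j' \notin symbol_set I ->
    symbol_set (lam r) = tnth l j |: symbol_set I ->
    symbol_set (lam s) = symbol_set l :\ tnth l j ->
    symbol_set (lam r') = tnth l j' |: symbol_set I ->
    symbol_set (lam s') = symbol_set l :\ tnth l j' ->
    (b r + b s = b r' + b s')%N.

(* The coordinate of a_1 /\ ... /\ a_k on e_lam is the maximal minor, on the
   columns lam, of the matrix with rows a_1, ..., a_k. *)
Definition pl_cone (T : realType) (z : 'I_m.+1 -> T[i]) : Prop :=
  (exists a : 'M[T[i]]_(k, n), forall i, z i = \det (colsub (tnth (lam i)) a))
  /\ exists i, z i != 0.

Definition plucker_permutation (T : realType) (sigma : {perm 'I_m.+1}) : Prop :=
  exists t : 'I_m.+1 -> T[i], (forall i, t i = 1 \/ t i = -1) /\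
    forall z : 'I_m.+1 -> T[i],
      pl_cone z -> pl_cone (fun i => t i * z (sigma i)).

Definition divisive (T : realType) (b : 'I_m.+1 -> nat) : Prop :=
  exists sigma : {perm 'I_m.+1}, plucker_permutation T sigma /\
    forall i i' : 'I_m.+1, i = i'.+1 :> nat -> (b (sigma i) %| b (sigma i'))%N.

(* The linear form Y_{lam^i} - (b_i / b_j) Y_{lam^j}.  It is only used for
   lam^i in R(lam^j); then i < j, and when b_i divides b_(i-1) for all i the
   quotient is exact. *)
Definition edge_form (b : 'I_m.+1 -> nat) (i j : 'I_m.+1) : {mpoly int[n]} :=
  Ysym int (lam i) - (b i %/ b j)%N%:R *: Ysym int (lam j).

(* The T^n-equivariant cohomology ring of Gr_b(k, n), as the image of the
   restriction to the fixed points. *)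
Definition equivariant_cohomology (b : 'I_m.+1 -> nat)
    (alpha : 'I_m.+1 -> {mpoly int[n]}) : Prop :=
  forall i j, lam i \in Rset (lam j) ->
    exists c : {mpoly int[n]}, alpha j - alpha i = edge_form b i j * c.

Definition schubert_class (b : 'I_m.+1 -> nat) (i : 'I_m.+1)
    (alpha : 'I_m.+1 -> {mpoly int[n]}) : Prop :=
  [/\ equivariant_cohomology b alpha,
      forall j, alpha j != 0 -> symbol_le (lam i) (lam j),
      alpha i = \prod_(l | lam l \in Rset (lam i)) edge_form b l i
    & forall j, alpha j \is (symbol_dim (lam i)).-homog].

Definition structure_constants (S : 'I_m.+1 -> 'I_m.+1 -> {mpoly int[n]})
    (C : 'I_m.+1 -> 'I_m.+1 -> 'I_m.+1 -> {mpoly rat[n]}) : Prop :=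
  forall i j p,
    map_mpoly intr (S i p) * map_mpoly intr (S j p) =
    \sum_l C i j l * map_mpoly intr (S l p).

(* Sums over multisets R of size d(lam^i) + d(lam^j) - d(lam^l) are written
   with |R| + d(lam^l) = d(lam^i) + d(lam^j): there is no such R when the
   difference is negative. *)
Definition knutson_tao (C : 'I_m.+1 -> 'I_m.+1 -> 'I_m.+1 -> {mpoly rat[n]})
    (K : 'I_m.+1 -> 'I_m.+1 -> 'I_m.+1 -> 'X_{1..n.-1} -> nat) : Prop :=
  forall i j l,
    C i j l =
    \sum_(R : 'X_{1..n.-1 < (symbol_dim (lam i) + symbol_dim (lam j)).+1}
            | (mdeg R + symbol_dim (lam l) ==
               symbol_dim (lam i) + symbol_dim (lam j))%N)
       (K i j l R)%:R * U_prod R.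

Definition cover_arrow : rel 'I_m.+1 := fun j i =>
  symbol_le (lam i) (lam j) && (symbol_dim (lam j) == (symbol_dim (lam i)).+1).

(* A chain l = l_0 -> l_1 -> ... -> l_r = q is given by p = (l_1, ..., l_r).
   Truncation of r is harmless: there is no chain when d(lam^l) < d(lam^q). *)
Definition Cg_const (b : 'I_m.+1 -> nat) (q : 'I_m.+1) (s : nat) (l : 'I_m.+1) :
    {mpoly rat[n]} :=
  let r := (symbol_dim (lam l) - symbol_dim (lam q))%N in
  \sum_(p : r.-tuple 'I_m.+1 | path cover_arrow l p && (last l p == q))
    (\prod_(x <- p) (b x)%:R)^-1 *:
    \sum_(J : {ffun 'I_r.+1 -> 'I_s.+1} | (\sum_t J t + r == s)%N)
      \prod_(t < r.+1)
        (- ((b (tnth [tuple of l :: p] t))%:R^-1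
            *: Ysym rat (lam (tnth [tuple of l :: p] t)))) ^+ J t.

End Weighted.

(* Main.v *)
Require Import Defs.
From HB Require Import structures.
From mathcomp Require Import all_boot all_order all_algebra all_fingroup.
From mathcomp Require Import reals.
From mathcomp Require Import complex.
From mathcomp Require Import mpoly.

Set Implicit Arguments.
Unset Strict Implicit.
Unset Printing Implicit Defensive.

From mathcomp Require Import zify ring.
Import Order.TTheory GRing.Theory Num.Theory.
Local Open Scope ring_scope.

(** Write g_p = - Y_p / b_p.  The substitution psi_p : y_r |-> y_r + w_r g_p
    sends the ordinary edge form Y_i - Y_p to the weighted one
    Y_i - (b_i / b_p) Y_p, and it is invertible because a > 0.  By uniqueness
    of the ordinary classes, the weighted class restricted to p is therefore
    psi_p of the ordinary one.  Applying psi_p to the ordinary product formula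
    expresses a product of weighted classes through the psi_p (U_R), which are
    polynomials in g_p with coefficients L_{s,R}.  Finally psi_p turns the
    ordinary equivariant Monk rule into
    (g_p - g_q) S_q = sum_{l -> q} S_l / b_q, and iterating it s times
    expands g^s S_q with the coefficients Cg_const. *)

(** * Schubert symbols *)

(** The substitution psi_p changes with the fixed point p, so divisibility along edges is not
    preserved for free. It survives because, at the two ends i and j of an edge, the inverse
    substitutions differ on every y_r by a multiple of Y_i - Y_j, which is the ordinary edge form
    itself.

    Uniqueness and the ordinary Monk rule both rest on a degree argument: a homogeneous class of
    degree d that vanishes at all symbols of dimension at most d is zero. For the Monk rule this
    leaves one constant per cover, computed by setting y_t = y_s for the exchanged pair.

    In the iteration, each factor g either stays at the current symbol l, contributing g_l, or
    climbs an arrow, contributing the inverse weight of the symbol it leaves. Over a chain with r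
    arrows the stays add up to the complete homogeneous polynomial of degree s - r in the g's of the
    chain, and the top symbol, which is never left, contributes no denominator. *)

Section Combinatorics.
Variables k n : nat.
Implicit Types lam mu : symbol k n.

(** Counting functions express the order through underlying sets ([symbol_leP]), so exchanges of
    elements can be compared without sorting tuples again. *)
Definition count_below lam (v : nat) : nat :=
  #|[set x in symbol_set lam | (x < v)%N]|.

(** An inversion is a possible downward exchange. Inversions index [Rset], and their number is the
    dimension, hence the degree of the diagonal value of a class. *)
Definition inversions lam : {set 'I_n * 'I_n} :=
  [set st | [&& st.1 \notin symbol_set lam, st.2 \in symbol_set lam
              & (st.1 < st.2)%N]].

Lemma ltn_tnth lam (i j : 'I_k) : (tnth lam i < tnth lam j)%N = (i < j)%N.
Proof.
have sorted_lam : sorted ltn (map val lam) by case: (lam).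
have mono (r s : 'I_k) : (r < s)%N -> (tnth lam r < tnth lam s)%N.
  move=> lt_rs; have x0 := tnth lam r.
  rewrite (tnth_nth x0 lam r) (tnth_nth x0 lam s).
  rewrite -!(nth_map x0 0%N val) ?size_tuple //.
  by rewrite (sorted_ltn_nth ltn_trans) ?inE ?size_map ?size_tuple.
case: (ltngtP i j) => [/mono // | /mono /ltnW | /val_inj ->].
  by rewrite ltnNge => ->.
by rewrite ltnn.
Qed.

Lemma tnth_symbol_inj lam : injective (tnth lam).
Proof.
move=> i j eq_ij; apply: ord_inj.
by case: (ltngtP i j) => //; rewrite -(ltn_tnth lam) eq_ij ltnn.
Qed.

Lemma symbol_setE lam : symbol_set lam = [set tnth lam r | r : 'I_k].
Proof.
apply/setP=> x; rewrite inE; apply/tnthP/imsetP => [[r ->]|[r _ ->]];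
  by exists r.
Qed.

Lemma mem_tnth_symbol lam r : tnth lam r \in symbol_set lam.
Proof. by rewrite inE mem_tnth. Qed.

Lemma card_symbol_set lam : #|symbol_set lam| = k.
Proof. by rewrite symbol_setE card_imset ?card_ord //; apply: tnth_symbol_inj. Qed.

Lemma count_belowE lam v :
  count_below lam v = #|[set r : 'I_k | (tnth lam r < v)%N]|.
Proof.
rewrite -(card_imset _ (@tnth_symbol_inj lam)) /count_below.
apply: eq_card => x; rewrite !inE; apply/andP/imsetP.
  by case=> /tnthP [r ->] lt_rv; exists r; rewrite ?inE.
by case=> r; rewrite inE => lt_rv ->; rewrite mem_tnth.
Qed.

Lemma card_ord_lt N v : (v <= N)%N -> #|[set r : 'I_N | (r < v)%N]| = v.
Proof.
move=> le_vN; have inj_w : injective (widen_ord le_vN).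
  by move=> x y /(congr1 val) /= /ord_inj.
rewrite -[RHS]card_ord -(card_imset predT inj_w).
apply: eq_card => s; rewrite !inE; apply/idP/imsetP => [lt_s|[x _ ->]].
  by exists (Ordinal lt_s) => //; apply: val_inj.
by rewrite /= ltn_ord.
Qed.

(** The entries below v occupy an initial segment of the positions. *)
Lemma tnth_lt_count lam (r : 'I_k) v :
  (tnth lam r < v)%N = (r < count_below lam v)%N.
Proof.
rewrite count_belowE.
apply/idP/idP => [lt_rv|].
  rewrite -[X in (X <= _)%N](card_ord_lt (ltn_ord r)).
  apply/subset_leq_card/subsetP => s; rewrite !inE ltnS => le_sr.
  by apply: leq_ltn_trans lt_rv; rewrite leqNgt ltn_tnth -leqNgt.
apply: contraLR; rewrite -!leqNgt => le_vr; rewrite -[X in (_ <= X)%N](card_ord_lt (ltnW (ltn_ord r))).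
apply/subset_leq_card/subsetP => s; rewrite !inE => lt_sv.
by rewrite -(ltn_tnth lam); apply: leq_trans le_vr.
Qed.

Lemma symbol_leP lam mu :
  reflect (forall v, count_below mu v <= count_below lam v)%N (symbol_le lam mu).
Proof.
apply: (iffP forallP) => [le_lm v|le_count r].
  rewrite !count_belowE; apply/subset_leq_card/subsetP => r; rewrite !inE.
  exact: leq_ltn_trans (le_lm r).
rewrite -ltnS tnth_lt_count; apply: leq_trans (le_count _).
by rewrite -tnth_lt_count.
Qed.

Lemma symbol_le_refl lam : symbol_le lam lam.
Proof. by apply/forallP. Qed.

Lemma symbol_le_trans lam mu nu :
  symbol_le lam mu -> symbol_le mu nu -> symbol_le lam nu.
Proof.
move=> /forallP le1 /forallP le2; apply/forallP => r.
exact: leq_trans (le1 r) (le2 r).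
Qed.

Lemma eq_symbol lam mu : (forall r, tnth lam r = tnth mu r :> nat) -> lam = mu.
Proof.
move=> eq_lm; apply/val_inj/eq_from_tnth => r; apply/val_inj; exact: eq_lm.
Qed.

Lemma symbol_le_antisym lam mu :
  symbol_le lam mu -> symbol_le mu lam -> lam = mu.
Proof.
move=> /forallP le1 /forallP le2; apply: eq_symbol => r.
by apply/eqP; rewrite eqn_leq le1 le2.
Qed.

Lemma symbol_set_inj : injective (@symbol_set k n).
Proof.
move=> lam mu eq_lm; apply: symbol_le_antisym; apply/symbol_leP => v;
  by rewrite /count_below eq_lm.
Qed.

Lemma symbol_of_set (A : {set 'I_n}) :
  #|A| = k -> exists lam, symbol_set lam = A.
Proof.
move=> cardA; have sizeA : size (enum A) == k by rewrite -cardE cardA.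
have sortedA : sorted ltn (map val (Tuple sizeA)).
  rewrite /= sorted_map /enum_mem sorted_filter //; first exact: ltn_trans.
  by rewrite -sorted_map -enumT val_enum_ord iota_ltn_sorted.
by exists (Symbol sortedA); apply/setP=> x; rewrite inE mem_enum.
Qed.

Lemma leq_tnth lam (r : 'I_k) : (r <= tnth lam r)%N.
Proof.
have: (r < count_below lam (tnth lam r).+1)%N by rewrite -tnth_lt_count.
move=> lt_r; rewrite -ltnS; apply: leq_trans lt_r _.
rewrite -[X in (_ <= X)%N](card_ord_lt (ltn_ord (tnth lam r))).
by apply/subset_leq_card/subsetP => x; rewrite !inE => /andP [].
Qed.

(** Of the values below the entry at position r, exactly r belong to the symbol; the remaining ones
    are the first components of the inversions ending at that entry. *)
Lemma symbol_dimE lam : symbol_dim lam = #|inversions lam|.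
Proof.
rewrite /symbol_dim -sum1dep_card.
rewrite -(pair_big_dep predT (fun s t => [&& s \notin symbol_set lam,
  t \in symbol_set lam & (s < t)%N]) (fun _ _ => 1%N)) /=.
rewrite (exchange_big_dep (mem (symbol_set lam))) /=; last first.
  by move=> s t _ /and3P [].
rewrite symbol_setE big_imset /=; last by move=> r s _ _ /tnth_symbol_inj.
apply: eq_bigr => r _; rewrite sum1dep_card -symbol_setE.
have -> : (tnth lam r - r = #|[set x : 'I_n | (x < tnth lam r)%N] :\: symbol_set lam|)%N.
  rewrite cardsD card_ord_lt 1?ltnW // setIC; congr (_ - _)%N.
  transitivity (count_below lam (tnth lam r)); last first.
    by apply: eq_card => x; rewrite !inE.
  rewrite count_belowE -[LHS](card_ord_lt (ltnW (ltn_ord r))).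
  by apply: eq_card => s; rewrite !inE ltn_tnth.
by apply: eq_card => x; rewrite !inE mem_tnth.
Qed.
End Combinatorics.

(** * Exchanges of one element, and covering relations *)

Section Moves.
Variables k n : nat.
Implicit Types lam mu : symbol k n.

Lemma mem_tperm lam mu s t x :
  s \notin symbol_set lam -> t \in symbol_set lam ->
  symbol_set mu = s |: (symbol_set lam :\ t) ->
  (tperm s t x \in symbol_set mu) = (x \in symbol_set lam).
Proof.
move=> s_lam t_lam ->; have neq_st : s != t by apply: contraNneq s_lam => ->.
rewrite in_setU1 in_setD1.
case: tpermP => [->|->|/eqP/negPf -> /eqP/negPf ->] //.
- by rewrite eq_sym (negPf neq_st) eqxx (negPf s_lam).
- by rewrite eqxx t_lam.
Qed.

Lemma Rset_P lam mu :
  reflect (exists2 st, st \in inversions lam &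
             symbol_set mu = st.1 |: (symbol_set lam :\ st.2))
          (mu \in Rset lam).
Proof.
rewrite !inE; apply: (iffP existsP) => [[s /existsP [t]]|[[s t]]].
  case/and4P=> s_mu t_mu lt_st /eqP eq_lam; exists (s, t).
    rewrite inE eq_lam /= !inE !eqxx lt_st /= orbF.
    by rewrite -val_eqE /= (ltn_eqF lt_st).
  rewrite /= eq_lam; apply/setP=> x; rewrite !inE.
  have [->|neq_xs] := eqVneq x s; first by move: s_mu; rewrite inE => ->.
  by case: eqVneq => [->|//] /=; move: t_mu; rewrite inE => /negPf ->.
rewrite inE /= => /and3P [s_lam t_lam lt_st] eq_mu.
exists s; apply/existsP; exists t; have neq_st : s != t.
  by rewrite -val_eqE /= (ltn_eqF lt_st).
rewrite eq_mu !inE eqxx (negPf neq_st) /= eq_sym (negPf neq_st) /= lt_st /=.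
rewrite eqxx; apply/eqP/setP=> x; rewrite !inE.
have [->|neq_xt] := eqVneq x t; first by move: t_lam; rewrite inE => ->.
by case: eqVneq => [->|//] /=; move: s_lam; rewrite inE => /negPf ->.
Qed.

(** The transposition of s and t maps the elements of [lam] below v into those of [mu] below v,
    since the only element it moves, t, goes down to s. *)
Lemma Rset_le lam mu : mu \in Rset lam -> symbol_le mu lam.
Proof.
case/Rset_P=> -[s t] /=; rewrite inE /= => /and3P [s_lam t_lam lt_st] eq_mu.
apply/symbol_leP => v; rewrite /count_below.
rewrite -(card_imset (mem [set x in symbol_set lam | (x < v)%N]) (@perm_inj _ (tperm s t))).
apply/subset_leq_card/subsetP => _ /imsetP [x + ->].
rewrite in_set => /andP [x_lam lt_xv]; rewrite in_set (mem_tperm _ s_lam) // x_lam.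
case: tpermP lt_xv x_lam => // [->|->] lt_v; first by rewrite (negPf s_lam).
by move=> _; apply: ltn_trans lt_v.
Qed.

Lemma Rset_neq lam mu : mu \in Rset lam -> mu != lam.
Proof.
case/Rset_P=> -[s t] /=; rewrite inE /= => /and3P [s_lam t_lam lt_st] eq_mu.
apply: contraNneq s_lam => <-; by rewrite eq_mu setU11.
Qed.

Lemma symbol_dim_sum lam :
  (symbol_dim lam + \sum_(r < k) r = \sum_(r < k) tnth lam r)%N.
Proof.
by rewrite -big_split; apply: eq_bigr => r _ /=; rewrite subnK // leq_tnth.
Qed.

Lemma symbol_le_eq lam mu :
  symbol_le lam mu -> (symbol_dim mu <= symbol_dim lam)%N -> lam = mu.
Proof.
move=> /[dup] le_lm /forallP le_r; rewrite -(leq_add2r (\sum_(r < k) r)%N).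
rewrite !symbol_dim_sum => le_sum.
apply: eq_symbol => r; apply/eqP; rewrite eqn_leq le_r /=.
move: le_sum; rewrite (bigD1 r) //= [X in (_ <= X)%N](bigD1 r) //=.
have : (\sum_(i < k | i != r) tnth lam i <= \sum_(i < k | i != r) tnth mu i)%N.
  by apply: leq_sum => i _.
by move: (bigop.body _ _ _) (bigop.body _ _ _) => A B; lia.
Qed.

(** The sums of the entries differ by one and no entry decreases, so exactly one entry changes, and
    it grows by one. *)
Lemma symbol_cover lam mu :
  symbol_le lam mu -> symbol_dim mu = (symbol_dim lam).+1 ->
  exists s t : 'I_n, [/\ t = s.+1 :> nat, s \in symbol_set lam,
    t \notin symbol_set lam, t \in symbol_set mu &
    symbol_set lam = s |: (symbol_set mu :\ t)].
Proof.
move=> /[dup] le_lm /forallP le_r dim_mu.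
have sum_mu : (\sum_(r < k) tnth mu r = (\sum_(r < k) tnth lam r).+1)%N.
  by rewrite -!symbol_dim_sum dim_mu.
have [r lt_r] : exists r, (tnth lam r < tnth mu r)%N.
  apply/existsP; apply: contraT; rewrite negb_exists => /forallP ge_r.
  move: sum_mu; rewrite (eq_bigr (fun r => nat_of_ord (tnth lam r))); last first.
    by move=> r _; apply/eqP; rewrite eqn_leq le_r andbT leqNgt.
  by move: (bigop.body _ _ _) => A; lia.
have eq_i i : i != r -> tnth mu i = tnth lam i.
  move=> neq_ir; apply/ord_inj/eqP; rewrite eqn_leq le_r andbT.
  move: sum_mu; rewrite (bigD1 r) // (bigD1 i) //= [in RHS](bigD1 r) // [in RHS](bigD1 i) //=.
  have : (\sum_(j < k | (j != r) && (j != i)) tnth lam j <=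
          \sum_(j < k | (j != r) && (j != i)) tnth mu j)%N.
    by apply: leq_sum => j _.
  move: (bigop.body _ _ _) (bigop.body _ _ _) => A B.
  by have := le_r i; move: lt_r; lia.
have eq_r : tnth mu r = (tnth lam r).+1 :> nat.
  move: sum_mu; rewrite (bigD1 r) // [in RHS](bigD1 r) //=.
  rewrite (eq_bigr (fun i => nat_of_ord (tnth lam i))) => [|i /eq_i -> //].
  by move: (bigop.body _ _ _) => A; lia.
have t_lam : tnth mu r \notin symbol_set lam.
  rewrite inE; apply/tnthP => -[i eq_ri].
  have [eq_ir|neq_ir] := eqVneq i r.
    by move: lt_r; rewrite eq_ri eq_ir ltnn.
  by move: eq_ri; rewrite -(eq_i _ neq_ir) => /tnth_symbol_inj /esym/eqP; apply/negP.
exists (tnth lam r), (tnth mu r); split=> //; rewrite ?mem_tnth_symbol //.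
apply/setP=> x; rewrite in_setU1 in_setD1 !inE; apply/tnthP/idP => [[i ->]|].
  have [->|neq_ir] := eqVneq i r; first by rewrite eqxx.
  rewrite -(eq_i _ neq_ir) mem_tnth andbT; apply/orP; right.
  by apply: contraNneq neq_ir => /tnth_symbol_inj ->.
case/orP => [/eqP ->|/andP [neq_x /tnthP [i eq_x]]]; first by exists r.
exists i; rewrite eq_x eq_i //; apply: contraNneq neq_x => <-.
by rewrite eq_x.
Qed.

Lemma Ysym_set (A : nzRingType) lam :
  Ysym A lam = \sum_(x in symbol_set lam) 'X_x :> {mpoly A[n]}.
Proof.
rewrite symbol_setE big_imset //= => r s _ _; exact: tnth_symbol_inj.
Qed.

Lemma Ysym_move (A : nzRingType) lam mu s t :
  s \notin symbol_set lam -> t \in symbol_set lam ->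
  symbol_set mu = s |: (symbol_set lam :\ t) ->
  Ysym A mu - Ysym A lam = 'X_s - 'X_t.
Proof.
move=> s_lam t_lam eq_mu; rewrite !Ysym_set eq_mu big_setU1 /=; last first.
  by rewrite in_setD1 (negPf s_lam) andbF.
by rewrite (big_setD1 t t_lam) /= opprD addrA [_ - 'X_t]addrAC addrK.
Qed.

Lemma exists_move lam st : st \in inversions lam ->
  exists mu, symbol_set mu = st.1 |: (symbol_set lam :\ st.2).
Proof.
case: st => s t; rewrite inE /= => /and3P [s_lam t_lam lt_st].
apply: symbol_of_set; rewrite cardsU1 in_setD1 (negPf s_lam) andbF /=.
by rewrite -[RHS](card_symbol_set lam) (cardsD1 t (symbol_set lam)) t_lam.
Qed.

End Moves.

(** * Divisibility by linear forms *)

Definition divides (A : comNzRingType) (f g : A) : Prop := exists c, g = f * c.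

Section Divides.
Variable A : comNzRingType.
Implicit Types f g h : A.

Lemma divides0 f : divides f 0.
Proof. by exists 0; rewrite mulr0. Qed.

Lemma divides_refl f : divides f f.
Proof. by exists 1; rewrite mulr1. Qed.

Lemma dividesD f g h : divides f g -> divides f h -> divides f (g + h).
Proof. by case=> c -> [d ->]; exists (c + d); rewrite mulrDr. Qed.

Lemma dividesN f g : divides f g -> divides f (- g).
Proof. by case=> c ->; exists (- c); rewrite mulrN. Qed.

Lemma dividesB f g h : divides f g -> divides f h -> divides f (g - h).
Proof. by move=> fg /dividesN; apply: dividesD. Qed.

Lemma divides_mull f g h : divides f g -> divides f (h * g).
Proof. by case=> c ->; exists (h * c); rewrite mulrCA. Qed.

Lemma divides_sum (I : Type) (r : seq I) (P : pred I) f (F : I -> A) :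
  (forall i, P i -> divides f (F i)) -> divides f (\sum_(i <- r | P i) F i).
Proof.
move=> divF; elim/big_ind: _ => //; first exact: divides0.
by move=> ? ? ? ?; apply: dividesD.
Qed.

Lemma divides_mulB f g g' h h' :
  divides f (g - g') -> divides f (h - h') -> divides f (g * h - g' * h').
Proof.
move=> fg fh; have -> : g * h - g' * h' = h * (g - g') + g' * (h - h') by ring.
by apply: dividesD; apply: divides_mull.
Qed.

End Divides.

(** * Substitutions and homogeneity *)

Section Substitution.
Variables (n : nat) (R : comNzRingType).
Local Notation P := {mpoly R[n]}.

(** Used in three ways: d = 0 gives equality of morphisms, d = y_s - y_t describes the kernel of
    [identify], and d an edge form compares the substitutions at two fixed points. *)
Lemma divides_rmorphB (A : comNzRingType) (phi psi : {rmorphism P -> A}) (d : A) :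
  (forall c, phi c%:MP = psi c%:MP) ->
  (forall i, divides d (phi 'X_i - psi 'X_i)) ->
  forall f, divides d (phi f - psi f).
Proof.
move=> eqC divX; elim/mpolyind => [|c mm f _ _ IH].
  by rewrite !rmorph0 subrr; apply: divides0.
rewrite !rmorphD /= opprD addrACA; apply: dividesD IH.
rewrite -mul_mpolyC !rmorphM /= eqC; apply: divides_mulB.
  by rewrite subrr; apply: divides0.
rewrite mpolyXE_id !rmorph_prod /=.
elim/big_rec2: _ => [|i x y _ IH]; first by rewrite subrr; apply: divides0.
apply: divides_mulB => //; elim: (mm i) => [|e IHe].
  by rewrite !expr0 !rmorph1 subrr; apply: divides0.
by rewrite !exprS !rmorphM; apply: divides_mulB.
Qed.

Lemma eq_rmorph_mpoly (A : comNzRingType) (phi psi : {rmorphism P -> A}) :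
  (forall c, phi c%:MP = psi c%:MP) -> (forall i, phi 'X_i = psi 'X_i) ->
  phi =1 psi.
Proof.
move=> eqC eqX f; apply/eqP; rewrite -subr_eq0.
have [|c ->] := @divides_rmorphB A phi psi 0 eqC _ f; last by rewrite mul0r.
by move=> i; rewrite eqX subrr; apply: divides0.
Qed.

Definition subst_mpoly (h : 'I_n -> P) : P -> P := mmap (@mpolyC n R) h.

HB.instance Definition _ h := GRing.RMorphism.on (subst_mpoly h).

Lemma subst_mpolyC h c : subst_mpoly h c%:MP = c%:MP.
Proof. exact: mmapC. Qed.

Lemma subst_mpolyX h i : subst_mpoly h 'X_i = h i.
Proof. by rewrite /subst_mpoly mmapX mmap1U. Qed.

Lemma subst_mpolyZ h c f : subst_mpoly h (c *: f) = c *: subst_mpoly h f.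
Proof. by rewrite -!mul_mpolyC rmorphM /= subst_mpolyC. Qed.

Lemma dhomog_big_prod (I : Type) (r : seq I) (Q : pred I) (F : I -> P) (d : I -> nat) :
  (forall i, Q i -> F i \is (d i).-homog) ->
  \prod_(i <- r | Q i) F i \is (\sum_(i <- r | Q i) d i).-homog.
Proof.
move=> homF; elim/big_rec2: _ => [|i x y Qi homy]; first exact: dhomog1.
by apply: dhomogM => //; apply: homF.
Qed.

Lemma dhomog_subst h d f : (forall i, h i \is 1.-homog) ->
  f \is d.-homog -> subst_mpoly h f \is d.-homog.
Proof.
move=> homh /dhomogP homf; rewrite /subst_mpoly /mmap big_seq.
apply: rpred_sum => mm /homf dE; rewrite mul_mpolyC; apply: rpredZ.
have {dE} -> : d = (\sum_(i < n) mm i)%N by rewrite -dE; apply: mdegE.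
apply: dhomog_big_prod => i _.
by rewrite -[X in X.-homog]mul1n; apply: dhomogMn.
Qed.

Lemma dhomog_mpolyX (i : 'I_n) : ('X_i : P) \is 1.-homog.
Proof. by rewrite dhomogX; apply/eqP/mdeg1. Qed.

End Substitution.

Section LinearFactors.
Variables (n : nat) (R : idomainType).
Local Notation P := {mpoly R[n]}.
Implicit Types (f : P) (st : 'I_n * 'I_n).

Definition diff_X st : P := 'X_st.1 - 'X_st.2.

(* Reduction modulo y_s - y_t. *)
Definition identify st : P -> P :=
  subst_mpoly (fun i => if i == st.2 then 'X_st.1 else 'X_i).

HB.instance Definition _ st := GRing.RMorphism.on (identify st).

Lemma mpolyXU_inj : injective (fun i : 'I_n => 'X_i : P).
Proof.
move=> i j /(congr1 (mcoeff U_(j))); rewrite !mcoeffXU eqxx.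
by case: eqVneq => // _ /eqP; rewrite eq_sym oner_eq0.
Qed.

(** The orientation s < t is essential: the reversed pair gives the opposite form, which is also
    killed. *)
Lemma identify_diff st st' :
  (st.1 < st.2)%N -> (st'.1 < st'.2)%N -> st != st' ->
  identify st (diff_X st') != 0.
Proof.
case: st st' => [s t] [s' t'] /= lt_st lt_st' neq_st.
rewrite rmorphB /= /identify !subst_mpolyX /= subr_eq0.
have -> : (if s' == t then 'X_s else 'X_s') = 'X_(if s' == t then s else s') :> P.
  by case: ifP.
have -> : (if t' == t then 'X_s else 'X_t') = 'X_(if t' == t then s else t') :> P.
  by case: ifP.
apply: contraNneq neq_st => /mpolyXU_inj.
move: lt_st lt_st'; case: eqVneq => [->|_]; case: eqVneq => [->|_].
- by rewrite ltnn.
- by move=> lt_st lt_tt' eq_st; move: lt_tt'; rewrite -eq_st ltnNge ltnW.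
- by move=> _ _ ->.
- by move=> _ + eq_st; rewrite eq_st ltnn.
Qed.

Lemma divides_diffP st f : divides (diff_X st) f <-> identify st f = 0.
Proof.
split=> [[c ->]|idf].
  rewrite rmorphM /= rmorphB /= /identify !subst_mpolyX eqxx.
  by case: eqP => [->|_]; rewrite subrr mul0r.
rewrite -[f]subr0 -idf.
apply: (@divides_rmorphB n R P idfun (identify st)) => [c|i] /=.
  by rewrite /identify subst_mpolyC.
rewrite /identify subst_mpolyX; case: eqP => [->|_].
  by rewrite -opprB; apply/dividesN/divides_refl.
by rewrite subrr; apply: divides0.
Qed.

(** Unique factorization is avoided: [identify] maps into a domain and keeps the other factors
    nonzero, so it must kill the cofactor, which is then divisible by the new factor. *)
Lemma divides_prod_diff (r : seq ('I_n * 'I_n)) f : uniq r ->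
  (forall st, st \in r -> (st.1 < st.2)%N) ->
  (forall st, st \in r -> divides (diff_X st) f) ->
  divides (\prod_(st <- r) diff_X st) f.
Proof.
elim: r => [|st r IH] /=; first by move=> _ _ _; exists f; rewrite big_nil mul1r.
case/andP=> st_r uniq_r ltr divr.
have [||c fE] := IH uniq_r.
- by move=> st' st'_r; apply: ltr; rewrite inE st'_r orbT.
- by move=> st' st'_r; apply: divr; rewrite inE st'_r orbT.
have /divides_diffP : divides (diff_X st) f by apply: divr; rewrite inE eqxx.
rewrite fE rmorphM /= => /eqP; rewrite mulf_eq0 rmorph_prod /= prodf_seq_eq0.
case/orP => [/hasP [st' st'_r /= /eqP idst]|/eqP /divides_diffP [c' ->]].
  have neq_st : st != st' by apply: contraNneq st_r => ->.
  have lt_st : (st.1 < st.2)%N by apply: ltr; rewrite inE eqxx.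
  have lt_st' : (st'.1 < st'.2)%N by apply: ltr; rewrite inE st'_r orbT.
  by have := identify_diff lt_st lt_st' neq_st; rewrite idst eqxx.
by exists c'; rewrite big_cons mulrA [_ * diff_X st]mulrC.
Qed.

Lemma dhomog_diff st : diff_X st \is 1.-homog.
Proof. by apply: rpredB; apply: dhomog_mpolyX. Qed.

Lemma dhomog_msizeE d f : f \is d.-homog -> f != 0 -> msize f = d.+1.
Proof.
move=> homf f0; rewrite -(prednK (n := msize f)) ?lt0n ?msize_poly_eq0 //.
congr _.+1; apply/esym/(dhomog_uniq f0 homf).
exact: dhomog_msize homf.
Qed.

(** [msize] minus one is additive over a domain, which leaves no room for c in the first case and
    size one in the second. *)
Lemma dhomog_quotient d e (p c : P) : p != 0 -> p \is d.-homog ->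
  p * c \is e.-homog ->
  ((e < d)%N -> c = 0) /\ (e = d -> exists x, c = x%:MP).
Proof.
move=> p0 homp hompc; have [->|c0] := eqVneq c 0.
  by split=> // _; exists 0; rewrite mpolyC0.
have pc0 : p * c != 0 by rewrite mulf_neq0.
have := msizeM p0 c0.
rewrite (dhomog_msizeE hompc) // (dhomog_msizeE homp) // addSn /= => sizeE.
have size_c : (0 < msize c)%N by rewrite lt0n msize_poly_eq0.
split=> [|eq_de]; first by lia.
exists c@_0; apply: msize1_polyC; lia.
Qed.

End LinearFactors.

Section IntToRat.
Variable n : nat.

Lemma dhomog_map_intr d (f : {mpoly int[n]}) :
  f \is d.-homog -> (map_mpoly intr f : {mpoly rat[n]}) \is d.-homog.
Proof.
move=> /dhomogP homf; apply/dhomogP => mm.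
by rewrite (perm_mem (msupp_map_mpoly _ (@intr_inj _))); apply: homf.
Qed.

End IntToRat.

(** * Ordinary equivariant Schubert classes *)

Section OrdinaryClasses.
Variables (k n : nat) (R : idomainType).
Local Notation P := {mpoly R[n]}.
Implicit Types (lam mu nu : symbol k n) (alpha : symbol k n -> P).

Definition gkm alpha : Prop := forall lam mu, mu \in Rset lam ->
  divides (Ysym R mu - Ysym R lam) (alpha lam - alpha mu).

Definition inv_prod lam : P := \prod_(st in inversions lam) diff_X R st.

(** The classes for weights all equal to 1, indexed by symbols; [prod_Rset] matches this diagonal
    value with the product over [Rset]. *)
Definition ordinary_schubert lam alpha : Prop :=
  [/\ gkm alpha, forall mu, alpha mu != 0 -> symbol_le lam mu,
      alpha lam = inv_prod lam
    & forall mu, alpha mu \is (symbol_dim lam).-homog].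

Lemma inversions_lt lam st : st \in inversions lam -> (st.1 < st.2)%N.
Proof. by rewrite inE => /and3P []. Qed.

Lemma mem_inversions lam (s t : 'I_n) : ((s, t) \in inversions lam) =
  [&& s \notin symbol_set lam, t \in symbol_set lam & (s < t)%N].
Proof. by rewrite in_set. Qed.

Lemma Rset_diff lam mu st : st \in inversions lam ->
  symbol_set mu = st.1 |: (symbol_set lam :\ st.2) ->
  Ysym R mu - Ysym R lam = diff_X R st.
Proof. by rewrite inE => /and3P [s_lam t_lam _]; apply: Ysym_move. Qed.

Lemma Rset_dim lam mu : mu \in Rset lam -> (symbol_dim mu < symbol_dim lam)%N.
Proof.
move=> Rmu; rewrite ltnNge; apply: contra (Rset_neq Rmu) => le_dim.
by apply/eqP/symbol_le_eq => //; apply: Rset_le.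
Qed.

Lemma diff_X_neq0 (st : 'I_n * 'I_n) : (st.1 < st.2)%N -> diff_X R st != 0.
Proof.
move=> lt_st; rewrite subr_eq0; apply/eqP => /mpolyXU_inj eq_st.
by rewrite eq_st ltnn in lt_st.
Qed.

Lemma inv_prod_neq0 lam : inv_prod lam != 0.
Proof. by apply/prodf_neq0 => st /inversions_lt /diff_X_neq0. Qed.

Lemma dhomog_inv_prod lam : inv_prod lam \is (symbol_dim lam).-homog.
Proof.
rewrite symbol_dimE -sum1_card; apply: dhomog_big_prod => st _.
exact: dhomog_diff.
Qed.

Lemma prod_Rset lam :
  \prod_(mu in Rset lam) (Ysym R mu - Ysym R lam) = inv_prod lam.
Proof.
(* The default is never taken on inversions, by [exists_move]. *)
pose f st := odflt lam
  [pick mu | symbol_set mu == st.1 |: (symbol_set lam :\ st.2)].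
have fP st : st \in inversions lam ->
    symbol_set (f st) = st.1 |: (symbol_set lam :\ st.2).
  move=> st_lam; rewrite /f; case: pickP => [mu /eqP //|no_mu].
  have [mu eq_mu] := exists_move st_lam.
  by have := no_mu mu; rewrite eq_mu eqxx.
have -> : Rset lam = f @: inversions lam.
  apply/setP=> mu; apply/Rset_P/imsetP => [[st st_lam eq_mu]|[st st_lam ->]].
    by exists st => //; apply: symbol_set_inj; rewrite fP.
  by exists st => //; apply: fP.
rewrite big_imset /= => [|st st' st_lam st'_lam eq_f].
  by apply: eq_bigr => st st_lam; apply: Rset_diff; rewrite ?fP.
have := fP _ st_lam; rewrite eq_f fP //.
case: st st' st_lam st'_lam {eq_f} => [s t] [s' t'] /=.
rewrite !mem_inversions => /and3P [s_lam t_lam lt_st] /and3P [s'_lam t'_lam lt_st'].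
(* The exchanged set determines the pair: s is its only new element and t the only missing one. *)
move=> /setP eq_set; congr (_, _).
  have := eq_set s; rewrite !in_setU1 eqxx !in_setD1.
  by rewrite (negPf s_lam) andbF orbF /= => /eqP.
have := eq_set t; rewrite !in_setU1 !in_setD1 eqxx t_lam.
have [eq_ts|_] := eqVneq t s; first by rewrite eq_ts (negPf s_lam) in t_lam.
have [eq_ts|_] := eqVneq t s'; first by rewrite eq_ts (negPf s'_lam) in t_lam.
by rewrite /= andbT => /negbFE/eqP.
Qed.

(** Each edge form at [lam] divides the value there, and these forms are differences of variables
    over distinct inversions, so their product divides it too. *)
Lemma gkm_divides alpha lam : gkm alpha ->
  (forall mu, mu \in Rset lam -> alpha mu = 0) ->
  divides (inv_prod lam) (alpha lam).
Proof.
move=> gkm_alpha alpha0; rewrite /inv_prod -big_enum.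
apply: divides_prod_diff => [|st|st]; first exact: enum_uniq.
  by rewrite mem_enum => /inversions_lt.
rewrite mem_enum => st_lam; have [mu eq_mu] := exists_move st_lam.
have Rmu : mu \in Rset lam by apply/Rset_P; exists st.
rewrite -(Rset_diff st_lam eq_mu) -[alpha lam]subr0 -(alpha0 _ Rmu).
exact: gkm_alpha.
Qed.

(* At a symbol of minimal dimension in the support, alpha is a multiple of
   inv_prod, whose degree is that dimension. *)
Lemma gkm_eq0 alpha d : gkm alpha -> (forall lam, alpha lam \is d.-homog) ->
  (forall lam, (symbol_dim lam <= d)%N -> alpha lam = 0) ->
  forall lam, alpha lam = 0.
Proof.
move=> gkm_alpha homa alpha0 lam; have [N] := ubnP (symbol_dim lam).
elim: N lam => // N IH lam; rewrite ltnS => le_N.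
have [/alpha0 //|lt_d] := leqP (symbol_dim lam) d.
have [c alphaE] : divides (inv_prod lam) (alpha lam).
  by apply: gkm_divides => // mu /Rset_dim lt_mu; apply: IH; apply: leq_trans le_N.
have := homa lam; rewrite alphaE.
case/(dhomog_quotient (inv_prod_neq0 lam) (dhomog_inv_prod lam)) => c0 _.
by rewrite c0 ?mulr0.
Qed.

Lemma gkmB alpha beta : gkm alpha -> gkm beta ->
  gkm (fun lam => alpha lam - beta lam).
Proof.
move=> gkma gkmb lam mu Rmu.
have -> : alpha lam - beta lam - (alpha mu - beta mu) =
  (alpha lam - alpha mu) - (beta lam - beta mu) by ring.
by apply: dividesB; [apply: gkma | apply: gkmb].
Qed.

Lemma gkm_sum (I : finType) (Q : pred I) (alpha : I -> symbol k n -> P) :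
  (forall i, Q i -> gkm (alpha i)) -> gkm (fun lam => \sum_(i | Q i) alpha i lam).
Proof.
move=> gkma lam mu Rmu; rewrite -[X in divides _ X]sumrB.
by apply: divides_sum => i Qi; apply: gkma.
Qed.

(** The factor is a degree-one class, since it changes along an edge by the edge form. It is
    normalized to vanish at [lam], which pushes the support of the product upwards. *)
Lemma gkm_mulY alpha lam : gkm alpha ->
  gkm (fun mu => (Ysym R lam - Ysym R mu) * alpha mu).
Proof.
move=> gkma mu nu Rnu; apply: divides_mulB; last exact: gkma.
by rewrite opprB [_ - _ + _]addrC addrA subrK; apply: divides_refl.
Qed.

(** The two diagonals agree, and by the support condition both classes vanish at every other symbol
    of dimension at most that of [lam]; [gkm_eq0] then applies to the difference. *)
Lemma ordinary_schubert_unique lam alpha beta :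
  ordinary_schubert lam alpha -> ordinary_schubert lam beta -> alpha =1 beta.
Proof.
case=> gkma suppa diaga homa [gkmb suppb diagb homb] mu.
apply/eqP; rewrite -subr_eq0; apply/eqP.
apply: (gkm_eq0 (alpha := fun mu => alpha mu - beta mu) (d := symbol_dim lam)).
- exact: gkmB.
- by move=> nu; apply: rpredB; [apply: homa | apply: homb].
move=> nu le_dim; have [->|neq_nu] := eqVneq nu lam; first by rewrite diaga diagb subrr.
have vanish (g : symbol k n -> P) : (forall nu, g nu != 0 -> symbol_le lam nu) -> g nu = 0.
  move=> suppg; apply: contraNeq neq_nu => /suppg le_nu.
  by rewrite eq_sym; apply/eqP/symbol_le_eq.
by rewrite !vanish ?subrr.
Qed.

Lemma dhomog_Ysym lam : Ysym R lam \is 1.-homog.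
Proof. by apply: rpred_sum => r _; apply: dhomog_mpolyX. Qed.

Lemma dhomog_mulY alpha lam mu d : alpha mu \is d.-homog ->
  (Ysym R lam - Ysym R mu) * alpha mu \is d.+1.-homog.
Proof.
by move=> homa; apply: (dhomogM (d := 1%N)) => //; apply: rpredB; apply: dhomog_Ysym.
Qed.

(* Exchanging s and t = s + 1 carries the inversions of lam to those of the
   covering symbol mu other than (s, t), so both products agree modulo
   y_s - y_t. *)
Lemma identify_inv_prod lam mu (s t : 'I_n) : t = s.+1 :> nat ->
  s \in symbol_set lam -> t \notin symbol_set lam ->
  s \notin symbol_set mu -> t \in symbol_set mu ->
  symbol_set lam = s |: (symbol_set mu :\ t) ->
  identify (s, t) (\prod_(st in inversions mu :\ (s, t)) diff_X R st) =
  identify (s, t) (inv_prod lam).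
Proof.
move=> tE s_lam t_lam s_mu t_mu lamE.
pose h (p : 'I_n * 'I_n) := (tperm s t p.1, tperm s t p.2).
have hK : involutive h by move=> [x y]; rewrite /h /= !tpermK.
rewrite !rmorph_prod /= (reindex_inj (inv_inj hK)) /=.
apply: eq_big => [[x y]|[x y] _]; last first.
  have idX z : identify (s, t) 'X_(tperm s t z) = identify (s, t) 'X_z.
    rewrite /identify !subst_mpolyX /=; case: tpermP => [->|->|//].
      by rewrite eqxx; case: ifP.
    by rewrite eqxx; case: ifP.
  by rewrite !rmorphB /= !idX.
have mem_h z : (tperm s t z \in symbol_set mu) = (z \in symbol_set lam).
  by rewrite -(mem_tperm _ s_mu t_mu lamE) tpermK.
rewrite in_setD1 /h /= !mem_inversions !mem_h.
case x_lam: (x \in symbol_set lam); first by rewrite andbF.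
case y_lam: (y \in symbol_set lam); last by rewrite andbF.
have neq_xs : x != s by apply: contraFneq x_lam => ->.
have neq_yt : y != t by apply: contraTneq y_lam => ->.
rewrite /= xpair_eqE.
(* As s and t are adjacent integers, the exchange reverses the order of no pair other than s, t. *)
case: tpermP => [/eqP|->|_ _]; first by rewrite (negPf neq_xs).
  rewrite eqxx /=; case: tpermP => [->|/eqP|neq_ys _].
  - by rewrite eqxx /= tE; lia.
  - by rewrite (negPf neq_yt).
  have : y <> t :> nat by move/ord_inj/eqP; rewrite (negPf neq_yt).
  have : y <> s :> nat by move/ord_inj.
  by rewrite neq_yt /= tE; lia.
rewrite (negPf neq_xs) /=; case: tpermP => [->|/eqP|//]; last by rewrite (negPf neq_yt).
have : x <> s :> nat by move/ord_inj/eqP; rewrite (negPf neq_xs).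
by rewrite tE; lia.
Qed.

(** By degree, the left side is a constant multiple of [inv_prod mu]. The constant is found by
    comparing [alpha mu] with [alpha lam = inv_prod lam] modulo y_s - y_t. *)
Lemma ordinary_schubert_cover lam mu alpha : ordinary_schubert lam alpha ->
  symbol_le lam mu -> symbol_dim mu = (symbol_dim lam).+1 ->
  (Ysym R lam - Ysym R mu) * alpha mu = inv_prod mu.
Proof.
case=> gkma suppa diaga homa le_lm dim_mu.
have [s [t [tE s_lam t_lam t_mu lamE]]] := symbol_cover le_lm dim_mu.
have s_mu : s \notin symbol_set mu.
  apply/negP => s_mu; have := card_symbol_set lam; rewrite lamE cardsU1 in_setD1 s_mu.
  have neq_st : s != t by apply: contraNneq t_lam => <-.
  rewrite neq_st /=; have := cardsD1 t (symbol_set mu).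
  rewrite card_symbol_set t_mu; move: #|_ :\ _| => N; lia.
have inv_st : (s, t) \in inversions mu by rewrite mem_inversions s_mu t_mu /= tE.
have Rlam : lam \in Rset mu by apply/Rset_P; exists (s, t).
have YE : Ysym R lam - Ysym R mu = diff_X R (s, t) by apply: Rset_diff.
(* Below [mu] the dimension is at most that of [lam], so the only possible support is [lam] itself,
   where the linear factor vanishes. *)
have [nu Rnu|c alphaE] := gkm_divides (lam := mu) (gkm_mulY lam gkma).
  have [->|neq_nu] := eqVneq nu lam; first by rewrite subrr mul0r.
  have [->|/suppa le_nu] := eqVneq (alpha nu) 0; first by rewrite mulr0.
  case/eqP: neq_nu; apply/esym/symbol_le_eq => //.
  by rewrite -ltnS -dim_mu; apply: Rset_dim.
have := dhomog_mulY lam (homa mu); rewrite alphaE.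
case/(dhomog_quotient (inv_prod_neq0 mu) (dhomog_inv_prod mu)) => _.
case=> [|x cE]; first by rewrite dim_mu.
suff c1 : c = 1 by rewrite c1 mulr1.
pose Pi : P := \prod_(st in inversions mu :\ (s, t)) diff_X R st.
have alpha_mu : alpha mu = Pi * c.
  apply: (mulfI (diff_X_neq0 (st := (s, t)) (inversions_lt inv_st))).
  by rewrite -YE alphaE /inv_prod (big_setD1 _ inv_st) /= YE mulrA.
have /divides_diffP : divides (diff_X R (s, t)) (alpha mu - alpha lam).
  by rewrite -YE; apply: gkma.
rewrite rmorphB /= diaga alpha_mu rmorphM /=.
rewrite (identify_inv_prod tE s_lam t_lam s_mu t_mu lamE).
rewrite cE /identify subst_mpolyC -/(identify (s, t)) -cE.
rewrite -{2}[identify _ _]mulr1 -mulrBr => /eqP; rewrite mulf_eq0 subr_eq0.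
(* The reduction kills no factor of [inv_prod lam]: s lies in [lam], so (s, t) is not among its
   inversions. *)
case/orP=> [|/eqP //]; rewrite rmorph_prod /= => /prodf_eq0 [[s' t'] st' /eqP id0].
have /eqP [] : identify (s, t) (diff_X R (s', t')) != 0; last exact: id0.
apply: identify_diff; [exact: inversions_lt inv_st|exact: inversions_lt st'|].
by apply: contraTneq st' => -[<- _]; rewrite mem_inversions s_lam.
Qed.

(** Both sides are classes of degree one more than the dimension of [lam], so they need only agree
    up to that dimension. There both vanish except at the covers of [lam], which
    [ordinary_schubert_cover] settles. *)
Lemma ordinary_monk (X : symbol k n -> symbol k n -> P) :
  (forall lam, ordinary_schubert lam (X lam)) -> forall lam mu,
  (Ysym R lam - Ysym R mu) * X lam mu =
  \sum_(nu | symbol_le lam nu && (symbol_dim nu == (symbol_dim lam).+1)) X nu mu.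
Proof.
move=> classX lam mu; apply/eqP; rewrite -subr_eq0; apply/eqP; move: mu.
have [gkml suppl diagl homl] := classX lam.
apply: (@gkm_eq0 _ (symbol_dim lam).+1).
- apply: gkmB; first exact: gkm_mulY.
  by apply: gkm_sum => nu _; case: (classX nu).
- move=> mu; apply: rpredB; first exact: dhomog_mulY.
  by apply: rpred_sum => nu /andP [_ /eqP <-]; have [_ _ _ ->] := classX nu.
move=> mu le_dim.
have other nu : symbol_dim nu = (symbol_dim lam).+1 -> nu != mu -> X nu mu = 0.
  move=> dim_nu; apply: contraNeq; case: (classX nu) => _ suppn _ _ /suppn le_nu.
  by apply/eqP/symbol_le_eq; rewrite ?dim_nu.
have [/andP [le_mu /eqP dim_mu]|not_cover] :=
  boolP (symbol_le lam mu && (symbol_dim mu == (symbol_dim lam).+1)).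
  rewrite (ordinary_schubert_cover (classX lam)) // (bigD1 mu) /=; last first.
    by rewrite le_mu dim_mu eqxx.
  have [_ _ -> _] := classX mu.
  rewrite big1 ?addr0 ?subrr // => nu /andP [/andP [_ /eqP dim_nu]].
  exact: other.
rewrite big1 ?subr0 => [|nu cover_nu]; last first.
  have /andP [_ /eqP dim_nu] := cover_nu; apply: other => //.
  by apply: contraNneq not_cover => <-.
have [->|neq_mu] := eqVneq mu lam; first by rewrite subrr mul0r.
have [->|/suppl le_mu] := eqVneq (X lam mu) 0; first by rewrite mulr0.
case/eqP: neq_mu; apply/esym/symbol_le_eq => //.
by move: not_cover; rewrite le_mu -ltnS => neq_dim; rewrite ltn_neqAle neq_dim.
Qed.

End OrdinaryClasses.

(** * Iterating the Monk rule *)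

Section CompleteHomogeneous.
Variable A : comNzRingType.
Implicit Types (x : A) (xs : seq A) (d : nat).

(* The complete homogeneous symmetric polynomial h_d, by the recursion
   h_(d+1)(x, xs) = x h_d(x, xs) + h_(d+1)(xs). *)
Fixpoint complete_sum xs : nat -> A :=
  match xs with
  | [::] => fun d => (d == 0)%:R
  | x :: xs' =>
    fix aux d := match d with
      | 0 => complete_sum xs' 0
      | d'.+1 => x * aux d' + complete_sum xs' d'.+1
      end
  end.

(** The series 1 / (1 - x X), truncated to remain a polynomial; coefficients of products in degrees
    below N are unaffected. *)
Definition geometric (N : nat) x : {poly A} := \sum_(j < N) x ^+ j *: 'X^j.

Lemma geometricP N x : geometric N x = 1 + x *: 'X * geometric N x - x ^+ N *: 'X^N.
Proof.
elim: N => [|N IH]; first by rewrite /geometric big_ord0 mulr0 addr0 !expr0 scale1r subrr.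
have E : geometric N.+1 x = geometric N x + x ^+ N *: 'X^N.
  by rewrite /geometric big_ord_recr.
have XE : x *: 'X * (x ^+ N *: 'X^N) = x ^+ N.+1 *: 'X^(N.+1) :> {poly A}.
  by rewrite -scalerAl -scalerAr scalerA -!exprS.
by rewrite E mulrDr XE {1}IH; ring.
Qed.

Lemma coef_prod_geometric N xs d : (d < N)%N ->
  (\prod_(x <- xs) geometric N x)`_d = complete_sum xs d.
Proof.
elim: xs d => [|x xs IH] d lt_dN; first by rewrite big_nil coef1.
have rec e : (e < N)%N -> (\prod_(y <- x :: xs) geometric N y)`_e =
    (\prod_(y <- xs) geometric N y)`_e +
    x * (if e == 0 then 0 else (\prod_(y <- x :: xs) geometric N y)`_e.-1).
  move=> lt_eN; rewrite !big_cons {1}geometricP mulrBl mulrDl mul1r -mulrA.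
  rewrite -!scalerAl coefB coefD !coefZ coefXnM lt_eN mulr0 subr0.
  by rewrite coefXM.
elim: d lt_dN => [|d IHd] lt_dN; rewrite rec //= ?mulr0 ?addr0 ?IH //.
by rewrite IHd 1?ltnW // addrC.
Qed.

Lemma sum_ffun_complete r (x : r.-tuple A) N d : (d < N)%N ->
  \sum_(J : {ffun 'I_r -> 'I_N} | (\sum_t J t)%N == d)
     \prod_(t < r) tnth x t ^+ J t = complete_sum x d.
Proof.
move=> lt_dN; rewrite -(coef_prod_geometric _ lt_dN) big_tuple bigA_distr_bigA /=.
rewrite coef_sum big_mkcond /=; apply: eq_bigr => J _.
have -> : \prod_(t < r) (tnth x t ^+ J t *: 'X^(J t)) =
    (\prod_(t < r) tnth x t ^+ J t) *: 'X^(\sum_t J t)%N :> {poly A}.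
  by rewrite scaler_prod prodrXr.
by rewrite coefZ coefXn eq_sym; case: eqP; rewrite ?mulr1 ?mulr0.
Qed.

(** The test guards against truncated subtraction, which for s < r would give h_0 = 1 instead of
    0. *)
Definition shifted_complete_sum xs r s : A :=
  if (r <= s)%N then complete_sum xs (s - r) else 0.

Lemma shifted_complete_sumS x xs r s :
  shifted_complete_sum (x :: xs) r.+1 s.+1 =
  x * shifted_complete_sum (x :: xs) r.+1 s + shifted_complete_sum xs r s.
Proof.
rewrite /shifted_complete_sum ltnS subSS; case: ltngtP => [lt_rs|_|->].
- by rewrite -(subnSK lt_rs).
- by rewrite mulr0 addr0.
- by rewrite subnn mulr0 add0r.
Qed.

End CompleteHomogeneous.

Section ChainSums.
Variables (I : finType) (e : rel I) (n : nat).
Variables (c : I -> rat) (g : I -> {mpoly rat[n]}) (q : I).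

(** The length r is a free parameter, not read off from dimensions, so that one can induct along the
    chain. *)
Definition chain_sum (r s : nat) (l : I) : {mpoly rat[n]} :=
  \sum_(p : r.-tuple I | path e l p && (last l p == q))
    (\prod_(x <- p) c x)^-1 *: shifted_complete_sum (map g (l :: p)) r s.

Lemma big_tupleS (r : nat) (Q : pred (seq I)) (F : seq I -> {mpoly rat[n]}) :
  \sum_(p : r.+1.-tuple I | Q p) F p =
  \sum_x \sum_(p : r.-tuple I | Q (x :: p)) F (x :: p).
Proof.
rewrite pair_big_dep /=.
rewrite (reindex (fun xp : I * r.-tuple I => [tuple of xp.1 :: xp.2])) //=.
exists (fun p : r.+1.-tuple I => (thead p, [tuple of behead p])) => [[x p]|p] _.
  by congr (_, _); apply: val_inj.
by rewrite /= -tuple_eta.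
Qed.

Lemma chain_sum0 s l : chain_sum 0 s l = if l == q then g l ^+ s else 0.
Proof.
rewrite /chain_sum big_mkcond (big_pred1 [tuple]) => [/=|p]; last first.
  by rewrite [p]tuple0; apply/esym/eqP.
rewrite big_nil invr1 scale1r /shifted_complete_sum /= subn0.
case: eqP => // _; elim: s => [|s IH] //=.
by rewrite IH addr0 exprS.
Qed.

Lemma chain_sumS r s l :
  chain_sum r.+1 s.+1 l =
  g l * chain_sum r.+1 s l + \sum_(x | e l x) (c x)^-1 *: chain_sum r s x.
Proof.
have expand s' : chain_sum r.+1 s' l =
    \sum_(x | e l x) \sum_(p : r.-tuple I | path e x p && (last x p == q))
      (c x * \prod_(y <- p) c y)^-1 *:
        shifted_complete_sum (map g [:: l, x & p]) r.+1 s'.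
  rewrite /chain_sum (@big_tupleS _ (fun p => path e l p && (last l p == q))
    (fun p => (\prod_(x <- p) c x)^-1 *: shifted_complete_sum (map g (l :: p)) r.+1 s')).
  rewrite [RHS]big_mkcond; apply: eq_bigr => x _ /=.
  case: (e l x) => /=; last by rewrite big_pred0.
  by apply: eq_bigr => p _; rewrite big_cons.
rewrite !expand mulr_sumr -big_split /=; apply: eq_bigr => x _.
rewrite /chain_sum mulr_sumr scaler_sumr -big_split /=; apply: eq_bigr => p _.
by rewrite shifted_complete_sumS scalerDr -scalerAr scalerA -invfM.
Qed.

End ChainSums.

(** * Generating function of the coefficients L_{s,R} *)

Section MultisetExpansion.
Variables (n : nat) (w : 'I_n -> int).

Definition weight_line (r : 'I_n.-1) : {poly {mpoly rat[n]}} :=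
  (consec_diff w r)%:~R *: 'X + (u_diff r)%:P.

(** With the product indexed by the elements of R counted with multiplicity, S is the set of factors
    from which the term in X is chosen. *)
Lemma coef_prod_weight_line (R : 'X_{1..n.-1}) s :
  (\prod_r weight_line r ^+ R r)`_s = L_coef w s R.
Proof.
have -> : \prod_r weight_line r ^+ R r =
    \prod_(x : {r : 'I_n.-1 & 'I_(R r)}) weight_line (tag x).
  rewrite -(sig_big_dep xpredT (fun _ => xpredT) (fun r _ => weight_line r)) /=.
  by apply: eq_bigr => r _; rewrite prodr_const card_ord.
rewrite bigA_distr coef_sum /L_coef [RHS]big_mkcond /=; apply: eq_bigr => S _.
rewrite (bigID (mem S)) /=.
rewrite (eq_bigr (fun x => (consec_diff w (tag x))%:~R *: 'X)) => [|x ->] //.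
rewrite [X in _ * X](eq_bigr (fun x => (u_diff (tag x))%:P)) => [|x /negPf ->] //.
rewrite scaler_prod prodr_const -[X in _ * X]rmorph_prod /=.
rewrite mulrC mul_polyC scalerA mulrC.
rewrite coefZ coefXn eq_sym; case: eqP => _; rewrite ?mulr1 ?mulr0 //.
by congr (_ * _); apply: eq_bigl => x; rewrite inE.
Qed.

Lemma L_coef_gt (R : 'X_{1..n.-1}) s : (mdeg R < s)%N -> L_coef w s R = 0.
Proof.
move=> lt_s; apply: big1 => S /eqP cardS; move: lt_s; rewrite -cardS ltnNge.
rewrite (_ : mdeg R = #|{: {r : 'I_n.-1 & 'I_(R r)}}|) ?max_card //.
by rewrite card_tagged mdegE sumnE big_map big_enum; apply: eq_bigr => r _; rewrite card_ord.
Qed.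

End MultisetExpansion.

(** * Weighted classes *)

Section Weighted.
Variables (k n m : nat) (lam : 'I_m.+1 -> symbol k n).
Hypothesis lam_enum : refining_enumeration lam.
Variables (b : 'I_m.+1 -> nat) (w : 'I_n -> int) (a : nat).
Hypothesis a_gt0 : (0 < a)%N.
Hypothesis b_gt0 : forall i, (0 < b i)%N.
Hypothesis bE : forall i, (b i)%:Z = a%:Z + \sum_(r < k) w (tnth (lam i) r).

Local Notation P := {mpoly rat[n]}.
Local Notation Y i := (Ysym rat (lam i)).
Local Notation bq i := ((b i)%:R : rat).
Local Notation "f ^Q" := (map_mpoly intr f : P) (at level 2, format "f ^Q").

(** Since g_j - g_i = (1 / b_i) (Y_i - (b_i / b_j) Y_j), these values form a degree-one class with
    rational coefficients. *)
Definition orbifold_generator (p : 'I_m.+1) : P := - (bq p)^-1 *: Y p.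
Local Notation g := orbifold_generator.

(* Evaluating the extra variable at g_p gives the substitution psi_p; the
   coefficients in that variable give L_coef. *)
Definition weight_shift : P -> {poly P} :=
  mmap (polyC \o @mpolyC n rat) (fun r => (w r)%:~R *: 'X + ('X_r)%:P).

HB.instance Definition _ := GRing.RMorphism.on weight_shift.

Definition twist (p : 'I_m.+1) : P -> P := horner_eval (g p) \o weight_shift.

HB.instance Definition _ p := GRing.RMorphism.on (twist p).

(** The weights on the symbol p add up to b_p - a, so psi_p sends Y_p to (a / b_p) Y_p. Hence (w_r /
    a) Y_p goes to (w_r / b_p) Y_p = - w_r g_p, which cancels the shift of y_r. *)
Definition untwist (p : 'I_m.+1) : P -> P :=
  subst_mpoly (fun r => 'X_r + ((w r)%:~R / a%:R) *: Y p).

HB.instance Definition _ p := GRing.RMorphism.on (untwist p).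

Lemma weight_shiftX r : weight_shift 'X_r = (w r)%:~R *: 'X + ('X_r)%:P.
Proof. by rewrite /weight_shift mmapX mmap1U. Qed.

Lemma twistC p c : twist p c%:MP = c%:MP.
Proof. by rewrite /twist /= /weight_shift mmapC /horner_eval hornerC. Qed.

Lemma twistZ p c f : twist p (c *: f) = c *: twist p f.
Proof. by rewrite -!mul_mpolyC rmorphM /= twistC. Qed.

Lemma twistX p r : twist p 'X_r = (w r)%:~R *: g p + 'X_r.
Proof.
by rewrite /twist /= weight_shiftX /horner_eval !hornerE scaler_int mulrzl.
Qed.

Lemma bq_neq0 p : bq p != 0.
Proof. by rewrite pnatr_eq0 -lt0n. Qed.

Lemma a_neq0 : a%:R != 0 :> rat.
Proof. by rewrite pnatr_eq0 -lt0n. Qed.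

Lemma sum_weights p : \sum_(r < k) (w (tnth (lam p) r))%:~R = bq p - a%:R.
Proof.
by rewrite -(rmorph_sum intr) /= [bq p]pmulrn bE intrD -pmulrn addrC addKr.
Qed.

Lemma twistY p q : twist p (Y q) = Y q + (bq q - a%:R) *: g p.
Proof.
rewrite -sum_weights scaler_suml -big_split rmorph_sum /=.
by apply: eq_bigr => r _; rewrite twistX addrC.
Qed.

Lemma untwistY p q : untwist p (Y q) = Y q + ((bq q - a%:R) / a%:R) *: Y p.
Proof.
rewrite -sum_weights mulr_suml scaler_suml -big_split rmorph_sum /=.
by apply: eq_bigr => r _; rewrite /untwist subst_mpolyX.
Qed.

Lemma scale_generator p : bq p *: g p = - Y p.
Proof. by rewrite scalerA mulrN mulfV ?bq_neq0 // scaleN1r. Qed.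

Lemma twist_untwist p f : twist p (untwist p f) = f.
Proof.
apply: (eq_rmorph_mpoly (phi := twist p \o untwist p) (psi := idfun)) => [c|r] /=.
  by rewrite /untwist subst_mpolyC twistC.
rewrite /untwist subst_mpolyX rmorphD /= twistX twistZ twistY.
rewrite scalerBl scale_generator addrA subrr sub0r scalerN [_ *: (a%:R *: _)]scalerA.
by rewrite divfK ?a_neq0 // addrAC subrr add0r.
Qed.

Section Class.
Hypothesis b_dvd : forall i i' : 'I_m.+1, i = i'.+1 :> nat -> (b i %| b i')%N.

Lemma b_dvd_le (i j : 'I_m.+1) : (i <= j)%N -> (b j %| b i)%N.
Proof.
case: j => j lt_j /=; elim: j lt_j => [|j IH] lt_j.
  by rewrite leqn0 => /eqP i0; rewrite (_ : Ordinal lt_j = i) //; apply: ord_inj.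
rewrite leq_eqVlt => /orP [/eqP i_j|].
  by rewrite (_ : Ordinal lt_j = i) //; apply: ord_inj.
rewrite ltnS => le_ij; apply: dvdn_trans (IH (ltnW lt_j) le_ij).
exact: b_dvd.
Qed.

Lemma edge_formQ i j : lam i \in Rset (lam j) ->
  (edge_form lam b i j)^Q = Y i - (bq i / bq j) *: Y j.
Proof.
move=> Rij; have le_ij : (i <= j)%N by case: lam_enum => _; apply; apply: Rset_le.
have YQ l : (Ysym int (lam l))^Q = Y l.
  by rewrite rmorph_sum; apply: eq_bigr => r _ /=; rewrite map_mpolyX.
rewrite /edge_form rmorphB /= map_mpolyZ /= !YQ; congr (_ - _ *: _).
rewrite (rmorph_nat intr) -{2}(divnK (b_dvd_le le_ij)) natrM mulfK //.
exact: bq_neq0.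
Qed.

(** Y_i gains ((b_i - a) / a) Y_j and Y_j is scaled by b_j / a, so the final coefficient of Y_j is
    (b_i - a) / a - b_i / a = -1. *)
Lemma untwist_edge i j : lam i \in Rset (lam j) ->
  untwist j (edge_form lam b i j)^Q = Y i - Y j.
Proof.
move=> Rij; rewrite edge_formQ // rmorphB /= {2}/untwist subst_mpolyZ.
rewrite -/(untwist j _) !untwistY !mulrBl divff ?a_neq0 // !scalerBl !scale1r.
rewrite [Y j + _]addrC subrK scalerA mulrA divfK ?bq_neq0 //.
by rewrite [_ - Y j]addrC addrA addrK.
Qed.

Lemma untwist_schubert (lam' : symbol k n -> 'I_m.+1) i alpha :
  cancel lam lam' -> cancel lam' lam ->
  schubert_class lam b i alpha ->
  ordinary_schubert (lam i) (fun mu => untwist (lam' mu) (alpha (lam' mu))^Q).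
Proof.
move=> lamK lam'K [gkma suppa diaga homa]; split.
- move=> la mu Rmu; set j := lam' la; set i' := lam' mu.
  have Rij : lam i' \in Rset (lam j) by rewrite !lam'K.
  have [c cE] := gkma _ _ Rij.
  (* The first term transports the weighted edge condition by one substitution; the second measures
     the change of substitution from j to i'. *)
  have -> : untwist j (alpha j)^Q - untwist i' (alpha i')^Q =
      untwist j (edge_form lam b i' j * c)^Q +
      (untwist j (alpha i')^Q - untwist i' (alpha i')^Q).
    by rewrite -cE !rmorphB /= addrA subrK.
  apply: dividesD.
    rewrite !rmorphM /= untwist_edge // !lam'K.
    by exists (untwist j c^Q).
  apply: divides_rmorphB => [x|r] /=; rewrite /untwist ?subst_mpolyC // !subst_mpolyX.
  exists (- ((w r)%:~R / a%:R)%:MP).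
  by rewrite !lam'K -!mul_mpolyC; ring.
- move=> mu nz; rewrite -[mu]lam'K; apply: suppa.
  by apply: contraNneq nz => ->; rewrite !rmorph0.
- rewrite lamK diaga !rmorph_prod /= -prod_Rset.
  rewrite [RHS](reindex lam) /=; last by exists lam' => x _; rewrite ?lamK ?lam'K.
  by apply: eq_bigr => l Rl; rewrite untwist_edge.
- move=> mu; apply: dhomog_subst => [r|]; last exact: dhomog_map_intr.
  by rewrite rpredD ?rpredZ ?dhomog_mpolyX ?dhomog_Ysym.
Qed.

End Class.
End Weighted.

(** * Recursion for the chain constants *)

Section ChainConstants.
Variables (k n m : nat) (lam : 'I_m.+1 -> symbol k n) (b : 'I_m.+1 -> nat).
Local Notation g := (orbifold_generator lam b).
Local Notation dim i := (symbol_dim (lam i)).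
Local Notation chains := (chain_sum (cover_arrow lam) (fun i => (b i)%:R) g).

Lemma Cg_chain_sum q s l :
  Cg_const lam b q s l = chains q (dim l - dim q) s l.
Proof.
rewrite /Cg_const /chain_sum; set r := (dim l - dim q)%N.
apply: eq_bigr => p _; congr (_ *: _); rewrite /shifted_complete_sum.
case: leqP => [le_rs|lt_sr]; last first.
  rewrite big_pred0 // => J; apply/negP => /eqP sumJ.
  by move: lt_sr; rewrite -sumJ ltnNge leq_addl.
have -> : [seq g i | i <- l :: p] = map_tuple g [tuple of l :: p] by [].
rewrite -(@sum_ffun_complete _ _ _ s.+1) ?ltnS ?leq_subr //.
apply: eq_big => [J|J _]; first by rewrite -[RHS](eqn_add2r r) subnK.
by apply: eq_bigr => t _; rewrite tnth_map /orbifold_generator scaleNr.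
Qed.

Lemma path_cover_le l p : path (cover_arrow lam) l p ->
  symbol_le (lam (last l p)) (lam l).
Proof.
elim: p l => [|x p IH] l /=; first by rewrite symbol_le_refl.
case/andP=> /andP [le_xl _] /IH le_x; exact: symbol_le_trans le_x le_xl.
Qed.

Lemma Cg_eq0 q s l : ~~ symbol_le (lam q) (lam l) -> Cg_const lam b q s l = 0.
Proof.
move=> not_le; rewrite /Cg_const big_pred0 // => p.
by apply: contraNF not_le => /andP [/path_cover_le + /eqP eq_q]; rewrite eq_q.
Qed.

Lemma Cg0 q l : Cg_const lam b q 0 l = (l == q)%:R.
Proof.
rewrite Cg_chain_sum; case dim_lq: (dim l - dim q)%N => [|r].
  by rewrite chain_sum0 expr0; case: eqP.
have -> : (l == q) = false.
  by apply: contraPF dim_lq => /eqP ->; rewrite subnn.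
by apply: big1 => p _; rewrite /shifted_complete_sum scaler0.
Qed.

(** Above the dimension of q this is [chain_sumS]. Otherwise r truncates to 0, only the empty chain
    is left, and each x below l has dimension less than q and contributes nothing. *)
Lemma CgS q s l : Cg_const lam b q s.+1 l =
  g l * Cg_const lam b q s l +
  \sum_(x | cover_arrow lam l x) (b x)%:R^-1 *: Cg_const lam b q s x.
Proof.
rewrite !Cg_chain_sum; have [le_lq|lt_ql] := leqP (dim l) (dim q).
  have /eqP -> : (dim l - dim q == 0)%N by rewrite subn_eq0.
  rewrite !chain_sum0 big1 => [|x /andP [_ /eqP dim_l]].
    by rewrite addr0 exprS; case: eqP => // _; rewrite mulr0.
  have lt_xq : (dim x < dim q)%N by rewrite -dim_l.
  rewrite Cg_chain_sum (_ : (dim x - dim q)%N = 0%N); last first.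
    by apply/eqP; rewrite subn_eq0 ltnW.
  rewrite chain_sum0; case: eqP => [x_q|]; last by rewrite scaler0.
  by move: lt_xq; rewrite x_q ltnn.
rewrite -(subnSK lt_ql) chain_sumS; congr (_ + _).
apply: eq_bigr => x /andP [_ /eqP dim_l].
by rewrite Cg_chain_sum dim_l subSS.
Qed.

End ChainConstants.

(** * Triangularity of Schubert classes *)

Section SchubertExpansion.
Variables (k n m : nat) (lam : 'I_m.+1 -> symbol k n).
Hypothesis le_index : forall i j, symbol_le (lam i) (lam j) -> (i <= j)%N.
Variables (X : 'I_m.+1 -> 'I_m.+1 -> {mpoly rat[n]}).
Hypothesis X_supp : forall i j, X i j != 0 -> symbol_le (lam i) (lam j).
Hypothesis X_diag : forall i, X i i != 0.

Lemma coefficients_eq0 (D : 'I_m.+1 -> {mpoly rat[n]}) :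
  (forall p, \sum_l D l * X l p = 0) -> forall l, D l = 0.
Proof.
move=> sumD l; have [N] := ubnP (nat_of_ord l); elim: N l => // N IH l.
rewrite ltnS => le_lN; have := sumD l; rewrite (bigD1 l) //= big1 ?addr0.
  by move/eqP; rewrite mulf_eq0 (negPf (X_diag l)) orbF => /eqP.
move=> x neq_xl; have [->|/X_supp/le_index le_xl] := eqVneq (X x l) 0.
  by rewrite mulr0.
rewrite IH ?mul0r //; apply: leq_trans le_lN.
by rewrite ltn_neqAle le_xl andbT.
Qed.

(** Evaluate at q, where the product vanishes. A term x other than q with X x q nonzero lies below
    q, hence is not above i either, and has coefficient 0 by induction on the index. *)
Lemma product_coefficient_eq0 i (D f : 'I_m.+1 -> {mpoly rat[n]}) :
  (forall p, X i p * f p = \sum_l D l * X l p) ->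
  forall q, ~~ symbol_le (lam i) (lam q) -> D q = 0.
Proof.
move=> sumD q; have [N] := ubnP (nat_of_ord q); elim: N q => // N IH q.
rewrite ltnS => le_qN not_le; have := sumD q; rewrite (bigD1 q) //= big1 ?addr0.
  have -> : X i q = 0 by apply: contraNeq not_le; apply: X_supp.
  by rewrite mul0r => /esym/eqP; rewrite mulf_eq0 (negPf (X_diag q)) orbF => /eqP.
move=> x neq_xq; have [->|/X_supp le_xq] := eqVneq (X x q) 0.
  by rewrite mulr0.
rewrite IH ?mul0r //; first by apply: leq_trans le_qN; rewrite ltn_neqAle neq_xq le_index.
by apply: contra not_le => le_ix; apply: symbol_le_trans le_xq.
Qed.

End SchubertExpansion.

Section WeightShift.
Variables (n : nat) (w : 'I_n -> int).

Lemma weight_shift_u r : weight_shift w (u_diff r) = weight_line w r.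
Proof.
rewrite /u_diff /consec_diff rmorphB /= !weight_shiftX /weight_line /u_diff.
by rewrite /consec_diff rmorphB /= polyCB scalerBl opprD addrACA.
Qed.

Lemma coef_weight_shift_U R s : (weight_shift w (U_prod R))`_s = L_coef w s R.
Proof.
suff -> : weight_shift w (U_prod R) = \prod_r weight_line w r ^+ R r.
  exact: coef_prod_weight_line.
rewrite rmorph_prod /=; apply: eq_bigr => r _.
by rewrite rmorphXn /= weight_shift_u.
Qed.

End WeightShift.

(** * Weighted classes as twists of ordinary ones *)

Section Comparison.
Variables (k n m : nat) (lam : 'I_m.+1 -> symbol k n).
Hypothesis lam_enum : refining_enumeration lam.
Variables (b : 'I_m.+1 -> nat) (w : 'I_n -> int) (a : nat).
Hypothesis a_gt0 : (0 < a)%N.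
Hypothesis b_gt0 : forall i, (0 < b i)%N.
Hypothesis bE : forall i, (b i)%:Z = a%:Z + \sum_(r < k) w (tnth (lam i) r).
Hypothesis b_dvd : forall i i' : 'I_m.+1, i = i'.+1 :> nat -> (b i %| b i')%N.
Variables (S S1 : 'I_m.+1 -> 'I_m.+1 -> {mpoly int[n]}).
Hypothesis S_schubert : forall i, schubert_class lam b i (S i).
Hypothesis S1_schubert : forall i, schubert_class lam (fun=> 1%N) i (S1 i).

Local Notation P := {mpoly rat[n]}.
Local Notation Y i := (Ysym rat (lam i)).
Local Notation "f ^Q" := (map_mpoly intr f : P) (at level 2, format "f ^Q").
Local Notation g := (orbifold_generator lam b).
Local Notation psi := (twist lam b w).

Lemma schubert_ordinary (lam' : symbol k n -> 'I_m.+1) i :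
  cancel lam lam' -> cancel lam' lam ->
  ordinary_schubert (lam i) (fun mu => (S1 i (lam' mu))^Q).
Proof.
move=> lamK lam'K.
(* Zero weights with a = 1 represent b = (1, ..., 1) and make [untwist] the identity, so
   [untwist_schubert] specializes to the ordinary case. *)
pose w0 (r : 'I_n) : int := 0.
have untwist0 p f : untwist lam w0 1 p f = f.
  apply: (eq_rmorph_mpoly (phi := untwist lam w0 1 p) (psi := idfun)).
    by move=> c; rewrite /= /untwist subst_mpolyC.
  by move=> r; rewrite /= /untwist subst_mpolyX mul0r scale0r addr0.
have one_E j : 1%:Z = 1%:Z + \sum_(r < k) w0 (tnth (lam j) r).
  by rewrite big1 ?addr0.
have := untwist_schubert (b := fun=> 1%N) (w := w0) lam_enum (ltn0Sn 0)
  (fun=> ltn0Sn 0) one_E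
  (fun _ _ _ => dvdnn 1) lamK lam'K (S1_schubert i).
case=> gkm1 supp1 diag1 hom1; split.
- by move=> la mu Rmu; have := gkm1 _ _ Rmu; rewrite !untwist0.
- by move=> mu nz; apply: supp1; rewrite untwist0.
- by rewrite -diag1 untwist0.
- by move=> mu; rewrite -[_^Q](untwist0 (lam' mu)); apply: hom1.
Qed.

Lemma twist_schubert i p : (S i p)^Q = psi p (S1 i p)^Q.
Proof.
have [[lam' lamK lam'K] _] := lam_enum.
have := ordinary_schubert_unique
  (untwist_schubert lam_enum a_gt0 b_gt0 bE b_dvd lamK lam'K (S_schubert i))
  (schubert_ordinary i lamK lam'K) (lam p).
by rewrite /= lamK => <-; rewrite twist_untwist.
Qed.

(** As Y_p + b_p g_p = 0, psi_p sends Y_q - Y_p to Y_q + b_q g_p = b_q (g_p - g_q); this is the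
    source of the denominator b_q. *)
Lemma weighted_monk q p : (g p - g q) * (S q p)^Q =
  \sum_(x | cover_arrow lam x q) (b q)%:R^-1 *: (S x p)^Q.
Proof.
have [[lam' lamK lam'K] _] := lam_enum.
pose X la mu := (S1 (lam' la) (lam' mu))^Q.
have classX la : ordinary_schubert la (X la).
  by rewrite -{1}[la]lam'K; apply: schubert_ordinary.
have := ordinary_monk classX (lam q) (lam p); rewrite /X !lamK.
move/(congr1 (psi p)); rewrite rmorphM rmorphB /= -twist_schubert.
rewrite !(twistY bE) rmorph_sum /= opprD addrACA -scalerBl opprB addrA subrK => monk.
have gE : g p - g q = (b q)%:R^-1 *: (Y q - Y p + ((b q)%:R - (b p)%:R) *: g p).
  rewrite scalerBl (scale_generator lam b_gt0) opprK [_ + Y p]addrC addrA subrK.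
  rewrite scalerDr [_ *: ((b q)%:R *: _)]scalerA mulVf ?(bq_neq0 b_gt0) // scale1r.
  by rewrite addrC; congr (_ + _); rewrite /orbifold_generator scaleNr opprK.
rewrite gE -scalerAl monk -scaler_sumr; congr (_ *: _).
rewrite (reindex lam) /=; last by exists lam' => x _; rewrite ?lamK ?lam'K.
by apply: eq_bigr => x _; rewrite lamK -twist_schubert.
Qed.

Lemma generator_power q p s :
  g p ^+ s * (S q p)^Q = \sum_l Cg_const lam b q s l * (S l p)^Q.
Proof.
elim: s => [|s IH].
  rewrite expr0 mul1r (bigD1 q) //= Cg0 eqxx mul1r big1 ?addr0 // => l neq_lq.
  by rewrite Cg0 (negPf neq_lq) mul0r.
have gS l : g p * (S l p)^Q = g l * (S l p)^Q +
    \sum_(x | cover_arrow lam x l) (b l)%:R^-1 *: (S x p)^Q.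
  by rewrite -weighted_monk -mulrDl addrC subrK.
rewrite exprS -mulrA IH mulr_sumr.
under eq_bigr do rewrite mulrCA gS mulrDr.
under [RHS]eq_bigr do rewrite CgS mulrDl.
rewrite !big_split /=; congr (_ + _); first by apply: eq_bigr => l _; ring.
under eq_bigr do rewrite mulr_sumr.
(* The Monk rule runs up from l to x; collecting the coefficient of S_x gives the sum over arrows
   leaving x in [CgS]. *)
rewrite (exchange_big_dep predT) //=; apply: eq_bigr => x _.
by rewrite mulr_suml; apply: eq_bigr => l _; rewrite -scalerAr -scalerAl.
Qed.

Lemma schubert_support i p : (S i p)^Q != 0 -> symbol_le (lam i) (lam p).
Proof.
by case: (S_schubert i) => _ supp _ _ nz; apply: supp; apply: contraNneq nz => ->; rewrite rmorph0.
Qed.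

Lemma schubert_diag i : (S i i)^Q != 0.
Proof.
have [[lam' lamK lam'K] _] := lam_enum.
have [_ _ diag _] :=
  untwist_schubert lam_enum a_gt0 b_gt0 bE b_dvd lamK lam'K (S_schubert i).
have := inv_prod_neq0 rat (lam i); rewrite -diag lamK.
by apply: contraNneq => ->; rewrite rmorph0.
Qed.

End Comparison.

(** * Assembly of the structure constants *)

Section StructureConstants.
Variables (k n m : nat) (lam : 'I_m.+1 -> symbol k n).
Variables (S1 : 'I_m.+1 -> 'I_m.+1 -> {mpoly int[n]}).
Variables (C1 : 'I_m.+1 -> 'I_m.+1 -> 'I_m.+1 -> {mpoly rat[n]}).
Variables (K : 'I_m.+1 -> 'I_m.+1 -> 'I_m.+1 -> 'X_{1..n.-1} -> nat).
Hypothesis K_def : knutson_tao lam C1 K.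
Local Notation dim i := (symbol_dim (lam i)).

Lemma coef_weight_shift_structure (w : 'I_n -> int) i j q s :
  (weight_shift w (C1 i j q))`_s =
  \sum_(R : 'X_{1..n.-1 < (dim i + dim j).+1}
          | (mdeg R + dim q == dim i + dim j)%N) (K i j q R)%:R * L_coef w s R.
Proof.
rewrite K_def rmorph_sum coef_sum; apply: eq_bigr => R _.
rewrite rmorphM /= rmorph_nat -coef_weight_shift_U.
by rewrite !mulr_natl coefMn.
Qed.

(** The range of s is the same for all q, so that the sums can be exchanged; higher coefficients
    vanish because s would exceed |R|. *)
Lemma twist_structure (b : 'I_m.+1 -> nat) (w : 'I_n -> int) i j q p :
  twist lam b w p (C1 i j q) =
  \sum_(s < (dim i + dim j).+1)
    (weight_shift w (C1 i j q))`_s * orbifold_generator lam b p ^+ s.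
Proof.
apply: horner_coef_wide; apply/leq_sizeP => s lt_s.
rewrite coef_weight_shift_structure big1 // => R _.
by rewrite L_coef_gt ?mulr0 //; apply: leq_trans (bmdeg R) lt_s.
Qed.

End StructureConstants.

Theorem theoremC (T : realType) (k n m : nat)
    (k_gt0 : (0 < k)%N) (k_lt_n : (k < n)%N) (mE : m.+1 = 'C(n, k))
    (lam : 'I_m.+1 -> symbol k n) (lam_enum : refining_enumeration lam)
    (b : 'I_m.+1 -> nat) (b_plucker : plucker_weight_vector lam b)
    (b_divisive : divisive lam T b)
    (b_dvd : forall i i' : 'I_m.+1, i = i'.+1 :> nat -> (b i %| b i')%N)
    (w : 'I_n -> int) (a : nat) (a_gt0 : (0 < a)%N)
    (bE : forall i, (b i)%:Z = a%:Z + \sum_(r < k) w (tnth (lam i) r))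
    (S : 'I_m.+1 -> 'I_m.+1 -> {mpoly int[n]})
    (S_schubert : forall i, schubert_class lam b i (S i))
    (C : 'I_m.+1 -> 'I_m.+1 -> 'I_m.+1 -> {mpoly rat[n]})
    (C_const : structure_constants S C)
    (S1 : 'I_m.+1 -> 'I_m.+1 -> {mpoly int[n]})
    (S1_schubert : forall i, schubert_class lam (fun=> 1%N) i (S1 i))
    (C1 : 'I_m.+1 -> 'I_m.+1 -> 'I_m.+1 -> {mpoly rat[n]})
    (C1_const : structure_constants S1 C1)
    (K : 'I_m.+1 -> 'I_m.+1 -> 'I_m.+1 -> 'X_{1..n.-1} -> nat)
    (K_def : knutson_tao lam C1 K)
    (i j l : 'I_m.+1) :
  C i j l =
  \sum_(q | [&& symbol_le (lam q) (lam l), symbol_le (lam i) (lam q)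
            & symbol_le (lam j) (lam q)])
    \sum_(R : 'X_{1..n.-1 < (symbol_dim (lam i) + symbol_dim (lam j)).+1}
            | (mdeg R + symbol_dim (lam q) ==
               symbol_dim (lam i) + symbol_dim (lam j))%N)
      \sum_(s < (mdeg R).+1)
        (K i j q R)%:R * L_coef w s R * Cg_const lam b q s l.
Proof.
have b_gt0 i' : (0 < b i')%N by case: b_plucker.
have one_gt0 (i' : 'I_m.+1) : (0 < 1)%N by [].
have [_ le_index] := lam_enum.
pose N := (symbol_dim (lam i) + symbol_dim (lam j)).+1.
pose D q : {poly {mpoly rat[n]}} := weight_shift w (C1 i j q).
pose X q p : {mpoly rat[n]} := map_mpoly intr (S q p).
pose X1 q p : {mpoly rat[n]} := map_mpoly intr (S1 q p).
(* All conditions on q are dropped and s runs over a uniform range; [C1_eq0], [Cg_eq0] and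
   [L_coef_gt] show that the extra terms are zero. *)
pose rhs l' := \sum_q \sum_(s < N) (D q)`_s * Cg_const lam b q s l'.
have C1_eq0 q : ~~ (symbol_le (lam i) (lam q) && symbol_le (lam j) (lam q)) ->
    C1 i j q = 0.
  have X1_supp i' p : X1 i' p != 0 -> symbol_le (lam i') (lam p).
    exact: (schubert_support S1_schubert).
  have X1_diag i' : X1 i' i' != 0.
    pose w0 (r : 'I_n) : int := 0.
    have one_E (x : 'I_m.+1) : 1%:Z = 1%:Z + \sum_(r < k) w0 (tnth (lam x) r).
      by rewrite big1 ?addr0.
    exact: (schubert_diag (b := fun=> 1%N) (w := w0) lam_enum (ltn0Sn 0) one_gt0
      one_E (fun _ _ _ => dvdnn 1) S1_schubert).
  rewrite negb_and => /orP [].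
    apply: (product_coefficient_eq0 le_index X1_supp X1_diag (f := X1 j)) => p.
    exact: C1_const.
  apply: (product_coefficient_eq0 le_index X1_supp X1_diag (f := X1 i)) => p.
  by rewrite mulrC; apply: C1_const.
have inner q : \sum_(R : 'X_{1..n.-1 < N}
      | (mdeg R + symbol_dim (lam q) == symbol_dim (lam i) + symbol_dim (lam j))%N)
      \sum_(s < (mdeg R).+1) (K i j q R)%:R * L_coef w s R * Cg_const lam b q s l =
    \sum_(s < N) (D q)`_s * Cg_const lam b q s l.
  under [RHS]eq_bigr do rewrite (coef_weight_shift_structure K_def) mulr_suml.
  rewrite exchange_big; apply: eq_bigr => R _ /=.
  rewrite (big_ord_widen N (fun s => (K i j q R)%:R * L_coef w s R * Cg_const lam b q s l)); last first.
    exact: bmdeg.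
  rewrite big_mkcond; apply: eq_bigr => s _; case: ifPn => //.
  by rewrite -leqNgt => /L_coef_gt ->; rewrite mulr0 mul0r.
under eq_bigr do rewrite inner.
have -> : C i j l = rhs l.
  (* By triangularity, equality of coefficients can be tested on the expansions at every fixed point
     p, where psi_p is available. *)
  apply/eqP; rewrite -subr_eq0; apply/eqP; move: l {inner}.
  apply: (coefficients_eq0 le_index (schubert_support S_schubert)
    (schubert_diag lam_enum a_gt0 b_gt0 bE b_dvd S_schubert)) => p.
  under eq_bigr do rewrite mulrBl.
  rewrite sumrB -C_const !(twist_schubert lam_enum a_gt0 b_gt0 bE b_dvd S_schubert S1_schubert).
  rewrite -rmorphM /= C1_const rmorph_sum /=; apply/eqP; rewrite subr_eq0; apply/eqP.
  under [RHS]eq_bigr do rewrite /rhs mulr_suml.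
  rewrite exchange_big; apply: eq_bigr => q _ /=.
  rewrite rmorphM /= -(twist_schubert lam_enum a_gt0 b_gt0 bE b_dvd S_schubert S1_schubert).
  rewrite (twist_structure K_def) mulr_suml.
  under [RHS]eq_bigr do rewrite mulr_suml.
  rewrite exchange_big; apply: eq_bigr => s _ /=.
  rewrite -mulrA (generator_power lam_enum a_gt0 b_gt0 bE b_dvd S_schubert S1_schubert).
  by rewrite mulr_sumr; apply: eq_bigr => l' _; rewrite mulrA.
rewrite /rhs [RHS]big_mkcond; apply: eq_bigr => q _; case: ifPn => //.
rewrite negb_and => /orP [not_le|/C1_eq0 C10].
  by rewrite big1 // => s _; rewrite Cg_eq0 ?mulr0.
by rewrite big1 // => s _; rewrite /D C10 rmorph0 coef0 mul0r.
Qed.
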